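(* Let $n\in\mathbb{N}$, $0<p<1$ and $T>0$. Then [CP] has a 1-parameter family of spatially inhomogeneous, radially symmetric, self-similar solutions $u_\alpha:\mathbb{R}^n\times[0,T]\to\mathbb{R}$, $0<\alpha<(1-p)^{1/(1-p)}$, of the form $$u_\alpha(x,t)=w_\alpha\!\left(\frac{|x|}{t^{1/2}}\right)t^{\frac{1}{1-p}}\ \text{ for } t\in(0,T],\qquad u_\alpha(x,0)=0,$$ with $w_\alpha:[0,\infty)\to\mathbb{R}$ and $w_\alpha(0)=\alpha$, such that $u_\alpha(\cdot,t)$ oscillates as $|x|\to\infty$ for each $t\in(0,T]$, and such that for every real $q>\frac{(1-p)n}{2}$ and each $t\in[0,T]$, $\|u_\alpha(\cdot,t)\|_q=\left(\int_{\mathbb{R}^n}|u_\alpha(x,t)|^q\,dx\right)^{1/q}$ is finite.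
   Context: Let $D_T=\mathbb{R}^n\times(0,T]$, $\bar D_T=\mathbb{R}^n\times[0,T]$, $\partial D_T=\mathbb{R}^n\times\{0\}$. A solution to [CP] is a function $u\in C^{2,1}(D_T)\cap C(\bar D_T)\cap L^\infty(\bar D_T)$ (where $C^{2,1}$ means twice continuously differentiable in $x$ and once in $t$) satisfying $u_t-\Delta u=u|u|^{p-1}$ on $D_T$ and $u=0$ on $\partial D_T$. ''Spatially inhomogeneous'' means that $u$ is not a function of $t$ only. ''$u_\alpha(\cdot,t)$ oscillates as $|x|\to\infty$'' means that the profile $w_\alpha$ (so that $u_\alpha(x,t)=w_\alpha(|x|/t^{1/2})t^{1/(1-p)}$) has no non-isolated zeros in $[0,\infty)$ and has infinitely many isolated zeros in $[\eta^*,\infty)$ for every $\eta^*\ge0$. *)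

(* Defs.v *)
From HB Require Import structures.
From mathcomp Require Import all_boot all_order all_algebra.
From mathcomp Require Import all_classical all_reals all_analysis.

Set Implicit Arguments.
Unset Strict Implicit.
Unset Printing Implicit Defensive.

Import Order.TTheory GRing.Theory Num.Theory.
Import numFieldNormedType.Exports.

Local Open Scope classical_set_scope.
Local Open Scope ring_scope.

(* The norm that the library puts on row vectors is the sup norm (with the same
   topology); |x| in the radial variable has to be the Euclidean one. *)
Definition enorm (R : realType) (n : nat) (x : 'rV[R]_n) : R :=
  Num.sqrt (\sum_i x 0 i ^+ 2).

Definition rV_display : measure_display.
Proof. exact: default_measure_display. Qed.

(* R^n carries the product sigma-algebra, i.e. the one generated by the
   coordinate functions, as is done in the library for n-tuples. *)
Section measurable_rV.
Context (R : realType) (n : nat).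

Let coors : 'I_n -> 'rV[R]_n -> R := fun i x => x 0 i.

Let rV_set0 : g_sigma_preimage coors set0.
Proof. exact: sigma_algebra0. Qed.

Let rV_setC A : g_sigma_preimage coors A -> g_sigma_preimage coors (~` A).
Proof. exact: sigma_algebraC. Qed.

Let rV_bigcup (F : (set 'rV[R]_n)^nat) :
  (forall i, g_sigma_preimage coors (F i)) ->
  g_sigma_preimage coors (\bigcup_i (F i)).
Proof. exact: sigma_algebra_bigcup. Qed.

HB.instance Definition _ := @isMeasurable.Build rV_display
  'rV[R]_n (g_sigma_preimage coors) rV_set0 rV_setC rV_bigcup.

End measurable_rV.

Lemma measurable_rVP (R : realType) d (T : measurableType d) (n : nat)
    (f : T -> 'rV[R]_n) :
  (forall i, measurable_fun [set: T] (fun t => f t 0 i)) ->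
  measurable_fun [set: T] f.
Proof.
move=> mf _ A mA; rewrite setTI.
pose G := [set B : set 'rV[R]_n | measurable (f @^-1` B)].
suff: A \in G by rewrite inE.
rewrite inE; apply: mA; split.
  split => [|B|F mF].
  - by rewrite /G /= preimage_set0.
  - by rewrite /G /= setTD preimage_setC => mB; exact: measurableC.
  - by rewrite /G /= preimage_bigcup; apply: bigcupT_measurable.
rewrite -bigcup_seq => B [i _ [C mC <-]]; rewrite /G /= setTI.
by have := mf i measurableT C mC; rewrite setTI.
Qed.

Definition rV_rcons (R : realType) (n : nat) (z : 'rV[R]_n * R) : 'rV[R]_n.+1 :=
  \row_i (if unlift ord_max i is Some j then z.1 0 j else z.2).

Lemma measurable_rV_rcons (R : realType) (n : nat) :
  measurable_fun [set: 'rV[R]_n * R] (@rV_rcons R n).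
Proof.
apply: measurable_rVP => i; rewrite /rV_rcons.
under eq_fun do rewrite mxE.
case: (unlift _ _) => [j|]; last exact: measurable_snd.
apply: (@measurableT_comp _ _ _ _ _ _ (fun x : 'rV[R]_n => x 0 j)).
  move=> _ Y mY; rewrite setTI; apply: sub_sigma_algebra => /=.
  rewrite -bigcup_seq/=; exists j => /=; first by rewrite mem_index_enum.
  by exists Y => //; rewrite setTI.
exact: measurable_fst.
Qed.

(* The product of mu with Lebesgue measure on R, as a measure on R^(n+1). *)
Section rcons_measure.
Local Open Scope ereal_scope.
Context (R : realType) (n : nat) (mu : {measure set 'rV[R]_n -> \bar R}).

Definition rcons_measure : set 'rV[R]_n.+1 -> \bar R :=
  pushforward (mu \x @lebesgue_measure R) (@rV_rcons R n).

Let rcons_measure0 : rcons_measure set0 = 0.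
Proof. by rewrite /rcons_measure /pushforward preimage_set0 measure0. Qed.

Let rcons_measure_ge0 A : 0 <= rcons_measure A.
Proof. by apply: integral_ge0 => x _; exact: measure_ge0. Qed.

Let rcons_measure_sigma_additive : semi_sigma_additive rcons_measure.
Proof.
have mf B : measurable B -> measurable (@rV_rcons R n @^-1` B).
  by move=> mB; have := measurable_rV_rcons measurableT mB; rewrite setTI.
move=> F mF tF mUF; rewrite /rcons_measure /pushforward preimage_bigcup.
apply: measure_semi_sigma_additive.
- by move=> i; exact: mf.
- apply/trivIsetP => /= i j _ _ ij; rewrite -preimage_setI.
  by move/trivIsetP : tF => /(_ _ _ _ _ ij) ->//; rewrite preimage_set0.
- by rewrite -preimage_bigcup; exact: mf.
Qed.

HB.instance Definition _ := isMeasure.Build _ _ _ rcons_measure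
  rcons_measure0 rcons_measure_ge0 rcons_measure_sigma_additive.

End rcons_measure.

Fixpoint lebesgue_rV (R : realType) (n : nat) :
    {measure set 'rV[R]_n -> \bar R} :=
  if n is m.+1 then rcons_measure (lebesgue_rV R m)
  else dirac (0 : 'rV[R]_0).

Definition DT (R : realType) (n : nat) (T : R) : set ('rV[R]_n * R) :=
  [set z | 0 < z.2 <= T].

Definition DTbar (R : realType) (n : nat) (T : R) : set ('rV[R]_n * R) :=
  [set z | 0 <= z.2 <= T].

Definition pd (R : realType) (n : nat) (i : 'I_n) (f : 'rV[R]_n -> R) :
    'rV[R]_n -> R :=
  'D_(delta_mx 0 i) f.

Definition pderivable (R : realType) (n : nat) (i : 'I_n) (f : 'rV[R]_n -> R)
    (x : 'rV[R]_n) : Prop :=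
  derivable f x (delta_mx 0 i).

Definition laplacian (R : realType) (n : nat) (f : 'rV[R]_n -> R)
    (x : 'rV[R]_n) : R :=
  \sum_i pd i (pd i f) x.

(* The time derivative is taken within (0, T]: it is two-sided for 0 < t < T
   and it is the left derivative at t = T. *)
Definition tderivable (R : realType) (T : R) (g : R -> R) (t : R) : Prop :=
  cvg (h^-1 * (g (t + h) - g t)
         @[h --> within [set h | 0 < t + h <= T] 0^']).

Definition td (R : realType) (T : R) (g : R -> R) (t : R) : R :=
  lim (h^-1 * (g (t + h) - g t)
         @[h --> within [set h | 0 < t + h <= T] 0^']).

(* u is C^{2,1} on D_T: the derivatives u_t, u_{x_i}, u_{x_i x_j} exist on D_T,
   and they are, like u, continuous there jointly in (x, t). *)
Definition C21 (R : realType) (n : nat) (T : R) (u : 'rV[R]_n -> R -> R) :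
    Prop :=
  [/\ {within @DT R n T, continuous (fun z => u z.1 z.2)},
      (forall x t, 0 < t <= T -> tderivable T (u x) t) /\
        {within @DT R n T, continuous (fun z => td T (u z.1) z.2)},
      forall i : 'I_n,
        (forall x t, 0 < t <= T -> pderivable i (u ^~ t) x) /\
        {within @DT R n T, continuous (fun z => pd i (u ^~ z.2) z.1)}
    & forall i j : 'I_n,
        (forall x t, 0 < t <= T -> pderivable j (pd i (u ^~ t)) x) /\
        {within @DT R n T, continuous (fun z => pd j (pd i (u ^~ z.2)) z.1)}].

Definition Linfty (R : realType) (n : nat) (T : R) (u : 'rV[R]_n -> R -> R) :
    Prop :=
  exists M : R,
    {ae (lebesgue_rV R n \x @lebesgue_measure R)%E,
       forall z, @DTbar R n T z -> `|u z.1 z.2| <= M}.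

(* A solution of [CP]. Functions on DTbar are represented by total functions
   whose values outside DTbar are irrelevant. At u = 0 the nonlinearity
   u |u|^(p-1) is 0, whatever the sign of p - 1. *)
Definition CP_solution (R : realType) (n : nat) (p T : R)
    (u : 'rV[R]_n -> R -> R) : Prop :=
  [/\ C21 T u,
      {within @DTbar R n T, continuous (fun z => u z.1 z.2)},
      Linfty T u,
      forall x t, 0 < t <= T ->
        td T (u x) t - laplacian (u ^~ t) x = u x t * `|u x t| `^ (p - 1)
    & forall x, u x 0 = 0].

Definition spatially_inhomogeneous (R : realType) (n : nat) (T : R)
    (u : 'rV[R]_n -> R -> R) : Prop :=
  ~ exists g : R -> R, forall x t, 0 <= t <= T -> u x t = g t.

Definition radially_symmetric (R : realType) (n : nat) (T : R)
    (u : 'rV[R]_n -> R -> R) : Prop :=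
  forall x y t, 0 <= t <= T -> enorm x = enorm y -> u x t = u y t.

(* A profile w : [0, +oo) -> R is represented by a total function of which only
   the values on [0, +oo) matter. That u(., t) oscillates as |x| -> +oo is, for
   a self-similar u, a property of its profile. *)
Definition zeros (R : realType) (w : R -> R) : set R :=
  [set eta | 0 <= eta /\ w eta = 0].

Definition oscillates (R : realType) (w : R -> R) : Prop :=
  zeros w `<=` isolated (zeros w) /\
  forall eta0, 0 <= eta0 ->
    infinite_set (isolated (zeros w) `&` [set eta | eta0 <= eta]).

(* Main.v *)
Require Import Defs.
From HB Require Import structures.
From mathcomp Require Import all_boot all_order all_algebra.
From mathcomp Require Import all_classical all_reals all_analysis.
From mathcomp Require Import measurable_realfun ring lra.

Import Order.TTheory GRing.Theory Num.Theory.
Import numFieldNormedType.Exports.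

Local Open Scope classical_set_scope.
Local Open Scope ring_scope.

(** In the variable [s = |x|^2 / t] the profile [W s = w (sqrt s)] of a self-similar
    solution solves [4 s W'' + (2 n + s) W' + f W = 0], where
    [f w = w |w|^(p-1) - w / (1 - p)] is continuous but not Lipschitz at [0].

    Existence: implicit Euler polygons for the pair [(W, W')], started at the singular
    point [s = 0], satisfy Lipschitz bounds that are uniform in the step, so their
    pointwise limit along an ultrafilter exists and solves the equation; no uniqueness
    is needed.

    Oscillation: the energy [2 s W'^2 + F W], with [F' = f], decreases, which confines
    [W] to [[-alpha, alpha]], where [w f w > 0]; it decreases slowly enough to stay
    positive, so all zeros are simple.  If [W] were positive from some point on, the
    equation would force [W' <= - c W^p / (2 n + s)], that is
    [(W^(1-p))' <= - c' / (2 n + s)], whose right-hand side has a divergent integral.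

    Decay: for large [s], adding the cross term [delta W W'] to the energy gives a
    Lyapunov function [J] with [s J' <= - k J], where [k] is proportional to [delta],
    as soon as [delta |W|^(1-p)] is small.  A small [delta] shows that [W] tends to [0];
    then every [delta] is admissible, so that [W] decays faster than any power of [s]
    and the [L^q] norms are finite for every [q > 0]. *)

(** * Derivatives *)

(* The derivation instances of the library are stated for pointwise operations such
   as [f + g] and do not unify reliably with functions written [fun x => f x + g x]. *)
Section derive_fun.
Context {R : realType}.
Implicit Types (f g : R -> R) (s a b c : R).

Lemma derE f s a b : a = b -> is_derive s 1 f a -> is_derive s 1 f b.
Proof. by move=> ->. Qed.

Lemma der_near f g s a : (\forall r \near s, f r = g r) ->
  is_derive s 1 f a -> is_derive s 1 g a.
Proof. exact: near_eq_is_derive. Qed.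

Lemma der_of_le f s a :
  (forall e : R, 0 < e -> exists2 d : R, 0 < d &
     forall h, `|h| <= d -> `|f (s + h) - f s - h * a| <= e * `|h|) ->
  is_derive s 1 f a.
Proof.
move=> H; suff L : h^-1 *: (f (h *: (1 : R) + s) - f s) @[h --> 0^'] --> a.
  by split; [apply/cvg_ex; exists a | apply/cvg_lim].
apply/cvgrPdist_le => e e0; have [d d0 {}H] := H _ e0.
near=> h.
have hn0 : h != 0 by near: h; exact: nbhs_dnbhs_neq.
have hd : `|h| <= d by near: h; exact: dnbhs0_le.
rewrite scaler1 [h + s]addrC /GRing.scale /=.
have -> : a - h^-1 * (f (s + h) - f s) = - (h^-1 * (f (s + h) - f s - h * a)).
  by field.
rewrite normrN normrM normfV ler_pdivrMl ?normr_gt0// [leRHS]mulrC.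
exact: H.
Unshelve. all: by end_near.
Qed.

Lemma der_id s : is_derive s 1 (fun x : R => x) 1.
Proof. exact: is_derive_id. Qed.

Lemma der_cst c s : is_derive s 1 (fun _ : R => c) 0.
Proof. exact: is_derive_cst. Qed.

Lemma der_add f g s a b : is_derive s 1 f a -> is_derive s 1 g b ->
  is_derive s 1 (fun x => f x + g x) (a + b).
Proof. exact: is_deriveD. Qed.

Lemma der_sub f g s a b : is_derive s 1 f a -> is_derive s 1 g b ->
  is_derive s 1 (fun x => f x - g x) (a - b).
Proof. exact: is_deriveB. Qed.

Lemma der_mul f g s a b : is_derive s 1 f a -> is_derive s 1 g b ->
  is_derive s 1 (fun x => f x * g x) (a * g s + f s * b).
Proof.
move=> fa gb; have := is_deriveM fa gb; apply: derE.
by rewrite /GRing.scale /= addrC mulrC [_ * b]mulrC [b * _]mulrC.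
Qed.

Lemma der_cmul c f s a : is_derive s 1 f a ->
  is_derive s 1 (fun x => c * f x) (c * a).
Proof. by move=> fa; apply: derE (der_mul _ _ _ _ _ (der_cst c s) fa); ring. Qed.

Lemma der_inv f s a : f s != 0 -> is_derive s 1 f a ->
  is_derive s 1 (fun x => (f x)^-1) (- a / f s ^+ 2).
Proof.
move=> f0 fa; have := is_deriveV f0 fa; apply: derE.
by rewrite /GRing.scale /= mulNr mulrC mulNr.
Qed.

Lemma der_comp f g s a b : is_derive (g s) 1 f a -> is_derive s 1 g b ->
  is_derive s 1 (fun x => f (g x)) (a * b).
Proof. exact: is_derive1_comp. Qed.

Lemma der_sqr f s a : is_derive s 1 f a ->
  is_derive s 1 (fun x => f x ^+ 2) (2 * f s * a).
Proof.
by move=> fa; apply: derE (der_mul _ _ _ _ _ fa fa); ring.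
Qed.

Lemma der_continuous f s a : is_derive s 1 f a -> {for s, continuous f}.
Proof.
by move=> [fd _]; apply: differentiable_continuous; exact/derivable1_diffP.
Qed.

Lemma near_le_exists s (P : R -> Prop) : (\forall r \near s, P r) ->
  exists2 d : R, 0 < d & forall r : R, `|r - s| <= d -> P r.
Proof.
move=> /nbhs_ballP[d /= d0 H]; exists (d / 2); first by rewrite divr_gt0.
move=> r rd; apply: H; rewrite /ball /= distrC (le_lt_trans rd)//.
by rewrite ltr_pdivrMr// ltr_pMr// ltr1n.
Qed.

Lemma der_mvt f (df : R -> R) (u v : R) :
  u < v -> (forall x : R, u < x < v -> is_derive x 1 f (df x)) -> continuous f ->
  exists2 c : R, u < c < v & f v - f u = df c * (v - u).
Proof.
move=> uv fd fc.
have fd' x : x \in `]u, v[ -> is_derive x 1 f (df x) by rewrite in_itv /= => /fd.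
have [|c] := MVT uv fd'; first exact: continuous_subspaceT.
by rewrite in_itv /= => cuv E; exists c.
Qed.

Lemma der_decr f (df : R -> R) (u v : R) :
  u < v -> (forall x : R, u < x < v -> is_derive x 1 f (df x)) -> continuous f ->
  (forall x : R, u < x < v -> df x < 0) -> f v < f u.
Proof.
move=> uv fd fc dn; have [c cuv E] := der_mvt _ _ _ _ uv fd fc.
by rewrite -subr_lt0 E nmulr_rlt0 ?dn// subr_gt0.
Qed.

Lemma der_nincr_oo f (df : R -> R) (u v : R) :
  u <= v -> (forall x : R, u < x < v -> is_derive x 1 f (df x)) -> continuous f ->
  (forall x : R, u < x < v -> df x <= 0) -> f v <= f u.
Proof.
rewrite le_eqVlt => /predU1P[->//|uv] fd fc dn.
have [c cuv E] := der_mvt _ _ _ _ uv fd fc.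
by rewrite -subr_le0 E mulr_le0_ge0 ?dn// subr_ge0 ltW.
Qed.

Lemma der_nincr f (df : R -> R) (u v : R) :
  u <= v -> (forall x, u <= x <= v -> is_derive x 1 f (df x)) ->
  (forall x, u <= x <= v -> df x <= 0) -> f v <= f u.
Proof.
rewrite le_eqVlt => /predU1P[->//|uv] fd dn.
have ab x : x \in `]u, v[%R -> u <= x <= v.
  by rewrite in_itv /= => /andP[? ?]; rewrite !ltW.
have [|c /ab cuv E] := MVT uv (fun x xuv => fd x (ab x xuv)).
  apply: continuous_in_subspaceT => x; rewrite inE /= in_itv /= => xuv.
  exact: der_continuous (fd x xuv).
by rewrite -subr_le0 E mulr_le0_ge0 ?dn// subr_ge0 ltW.
Qed.

Lemma der_ndecr f (df : R -> R) (u v : R) :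
  u <= v -> (forall x, u <= x <= v -> is_derive x 1 f (df x)) ->
  (forall x, u <= x <= v -> 0 <= df x) -> f u <= f v.
Proof.
move=> uv fd dn; rewrite -lerN2.
apply: (der_nincr (fun x => - f x) (fun x => - df x)) => // x xuv.
  exact: is_deriveN (fd x xuv).
by rewrite oppr_le0 dn.
Qed.

Lemma der_weight (c d s : R) : 0 < s ->
  is_derive s 1 (fun x => expR (c * ln x + d * x)) (expR (c * ln s + d * s) * (c / s + d)).
Proof.
move=> s0; apply: (der_comp expR _ _ _ _ (is_derive_expR _)).
apply: der_add; first by apply: der_cmul; exact: is_derive1_ln.
by apply: derE (der_cmul d _ _ _ (der_id s)); rewrite mulr1.
Qed.

Lemma real_induction (P : R -> Prop) : P 0 ->
  (forall s : R, 0 <= s -> (forall r : R, 0 <= r <= s -> P r) ->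
     exists2 d : R, 0 < d & forall r : R, s <= r <= s + d -> P r) ->
  (forall s : R, 0 < s -> (forall r : R, 0 <= r < s -> P r) -> P s) ->
  forall s : R, 0 <= s -> P s.
Proof.
move=> P0 Pr Pl s1 s10; apply: contrapT => nP.
pose S := [set s : R | 0 <= s /\ forall r : R, 0 <= r <= s -> P r].
have S0 : S 0.
  by split=> // r; rewrite -eq_le => /eqP <-.
have Sub s : S s -> s <= s1.
  move=> [s0 H]; rewrite leNgt; apply/negP => ss1; apply: nP; apply: H.
  by rewrite s10 ltW.
have supS : has_sup S by split; [exists 0|exists s1].
have t0 : 0 <= sup S by apply: ub_le_sup => //; exists s1.
have Hlt r : 0 <= r < sup S -> P r.
  move=> /andP[r0 rS]; have e0 : 0 < sup S - r by rewrite subr_gt0.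
  have [s [_ Hs] rs] := sup_adherent e0 supS.
  by apply: Hs; rewrite r0 ltW//; move: rs; rewrite subKr.
have HS r : 0 <= r <= sup S -> P r.
  move=> /andP[r0]; rewrite le_eqVlt => /predU1P[E|rS]; last by apply: Hlt; rewrite r0.
  move: r0; rewrite le_eqVlt => /predU1P[<-//|r0].
  by apply: Pl => // r'; rewrite E; exact: Hlt.
have [d d0 Hd] := Pr _ t0 HS.
have : S (sup S + d).
  split; first by rewrite addr_ge0// ltW.
  move=> r /andP[r0 rS]; have [h|h] := leP r (sup S); first by apply: HS; rewrite r0.
  by apply: Hd; rewrite rS ltW.
move=> /(ub_le_sup _) => /(_ (ex_intro _ s1 Sub)).
by rewrite gerDl leNgt d0.
Qed.

End derive_fun.

(** * Existence of profiles *)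

Section euler_scheme.
Context {R : realType}.
Variables (f : R -> R) (a N M L B C D h : R).
Hypotheses (N_gt0 : 0 < N) (h_gt0 : 0 < h) (L_ge0 : 0 <= L).
Hypothesis f_bounded : forall x, `|f x| <= M.
Hypothesis f_lip : forall x, `|f x - f a| <= L * `|x - a|.
Hypotheses (B_ge : M <= N * B) (C_ge : (L + 1) * B <= N * C).
Hypothesis D_ge : N * C + 2 * B + (L + 1) * B <= 4 * D.

Fixpoint euler (j : nat) : R * R :=
  if j is i.+1 then
    ((euler i).1 + h * (euler i).2,
     (4 * i.+1%:R * (euler i).2 - f (euler i).1)
       / (4 * i.+1%:R + N + i.+1%:R * h))
  else (a, - f a / N).

Let M_ge0 : 0 <= M.
Proof. exact: le_trans (f_bounded a). Qed.

Let h_ge0 : 0 <= h. Proof. exact: ltW. Qed.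

Let N_ge0 : 0 <= N. Proof. exact: ltW. Qed.

Let Nv_ge0 : 0 <= N^-1. Proof. by rewrite invr_ge0. Qed.

Let B_ge0 : 0 <= B.
Proof. by rewrite -(pmulr_rge0 _ N_gt0) (le_trans M_ge0). Qed.

Let C_ge0 : 0 <= C.
Proof.
rewrite -(pmulr_rge0 _ N_gt0); apply: le_trans C_ge.
by rewrite mulr_ge0// addr_ge0.
Qed.

#[local] Hint Resolve M_ge0 Nv_ge0 h_ge0 N_ge0 B_ge0 C_ge0 : core.

Let den_gt0 i : 0 < 4 * i.+1%:R + N + i.+1%:R * h.
Proof. by rewrite !addr_gt0 ?mulr_gt0. Qed.

Lemma eulerS2 j : 4 * j.+1%:R * ((euler j.+1).2 - (euler j).2) =
  - (N + j.+1%:R * h) * (euler j.+1).2 - f (euler j).1.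
Proof.
have := den_gt0 j; rewrite /=; move: j.+1%:R => n den.
have den0 : 4 * n + N + n * h != 0 by rewrite gt_eqF.
by field.
Qed.

Lemma euler2_le j : `|(euler j).2| <= B.
Proof.
elim: j => [|j IH].
  by rewrite /= normrM normrN normfV (gtr0_norm N_gt0) ler_pdivrMr// mulrC (le_trans _ B_ge).
rewrite /= normrM normfV (gtr0_norm (den_gt0 j)) ler_pdivrMr//.
apply: le_trans (ler_normB _ _) _.
rewrite normrM ger0_norm; last by rewrite mulr_ge0.
have : 4 * j.+1%:R * `|(euler j).2| <= 4 * j.+1%:R * B.
  by rewrite ler_wpM2l// mulr_ge0.
have : `|f (euler j).1| <= N * B by exact: le_trans B_ge.
have : 0 <= j.+1%:R * h * B by rewrite !mulr_ge0.
by rewrite mulrDr mulrDr; lra.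
Qed.

Lemma euler1_le j : `|(euler j).1 - a| <= B * (j%:R * h).
Proof.
elim: j => [|j IH]; first by rewrite /= subrr normr0 !mul0r mulr0.
rewrite /= addrAC; apply: le_trans (ler_normD _ _) _.
rewrite normrM (gtr0_norm h_gt0) -natr1 mulrDl mul1r mulrDr lerD//.
by rewrite mulrC ler_wpM2r ?euler2_le// ltW.
Qed.

Lemma euler_source j : `|- (f (euler j).1 - f a) + j.+1%:R * h * (f a / N)|
  <= (L + 1) * B * (j.+1%:R * h).
Proof.
apply: le_trans (ler_normD _ _) _; rewrite normrN mulrDl mulrDl mul1r lerD//.
  apply: le_trans (f_lip _) _; rewrite -mulrA ler_wpM2l//.
  apply: le_trans (euler1_le _) _; rewrite ler_wpM2l// ler_pM2r//.
  by rewrite ler_nat.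
rewrite normrM ger0_norm; last by rewrite mulr_ge0.
rewrite mulrC ler_wpM2r//; first by rewrite mulr_ge0.
by rewrite normrM normfV (gtr0_norm N_gt0) ler_pdivrMr// mulrC (le_trans _ B_ge).
Qed.

Lemma euler_dev j : 4 * j.+1%:R * ((euler j.+1).2 - (euler j).2) =
  - (N + j.+1%:R * h) * ((euler j.+1).2 - (euler 0).2)
  + (- (f (euler j).1 - f a) + j.+1%:R * h * (f a / N)).
Proof.
rewrite eulerS2 /=; set y := _ / (_ + _).
by have := gt_eqF N_gt0 => /negbT N0; field.
Qed.

Lemma euler2_dev j : `|(euler j).2 - (euler 0).2| <= C * (j%:R * h).
Proof.
elim: j => [|j IH]; first by rewrite subrr normr0 !mul0r mulr0.
have := euler_dev j; have := euler_source j.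
set r := - (_ - _) + _ => rle.
move: IH; set y0 := (euler 0).2; set y := (euler j).2; set y1 := (euler j.+1).2.
move=> IH E.
have -> : y1 - y0 = (4 * j.+1%:R * (y - y0) + r) / (4 * j.+1%:R + N + j.+1%:R * h).
  apply: (mulIf (lt0r_neq0 (den_gt0 j))); rewrite divfK ?gt_eqF//.
  rewrite (_ : y - y0 = (y1 - y0) - (y1 - y)); last by ring.
  by rewrite mulrBr E; ring.
rewrite normrM normfV (gtr0_norm (den_gt0 j)) ler_pdivrMr//.
apply: le_trans (ler_normD _ _) _.
rewrite normrM ger0_norm; last by rewrite mulr_ge0.
have h1 : 4 * j.+1%:R * `|y - y0| <= 4 * j.+1%:R * (C * (j.+1%:R * h)).
  rewrite ler_wpM2l// ?mulr_ge0//; apply: le_trans IH _.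
  by rewrite ler_wpM2l// ler_pM2r// ler_nat.
have h2 : (L + 1) * B * (j.+1%:R * h) <= N * C * (j.+1%:R * h).
  by rewrite ler_wpM2r// mulr_ge0.
have h3 : 0 <= C * (j.+1%:R * h) * (j.+1%:R * h) by rewrite !mulr_ge0.
move: rle h1 h2 h3; move: `|r| `|y - y0| (j.+1%:R * h) => r' e s.
lra.
Qed.

Lemma euler2_step j : `|(euler j.+1).2 - (euler j).2| <= D * h.
Proof.
have := euler_source j; have := euler_dev j; have := euler2_dev j.+1.
set r := - (_ - _) + _.
have := euler2_le 0; have := euler2_le j.+1.
set y0 := (euler 0).2; set y := (euler j).2; set y1 := (euler j.+1).2.
move=> y1B y0B e1 E rle.
have j0 : 0 < j.+1%:R :> R by [].
rewrite -(@ler_pM2l _ (4 * j.+1%:R)); last by rewrite mulr_gt0.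
rewrite -[X in X * `|_|]ger0_norm ?mulr_ge0// -normrM E.
apply: le_trans (ler_normD _ _) _; rewrite normrM normrN.
have s0 : 0 <= j.+1%:R * h by rewrite mulr_ge0.
rewrite (ger0_norm (addr_ge0 N_ge0 s0)).
have h1 : N * `|y1 - y0| <= N * C * (j.+1%:R * h).
  by rewrite -mulrA ler_wpM2l.
have h2 : j.+1%:R * h * `|y1 - y0| <= j.+1%:R * h * (2 * B).
  rewrite ler_wpM2l//; apply: le_trans (ler_normB _ _) _; lra.
have h3 := ler_wpM2r s0 D_ge.
rewrite mulrDl; lra.
Qed.

Lemma euler2_lip i j : `|(euler i).2 - (euler j).2| <= D * `|i%:R * h - j%:R * h|.
Proof.
wlog ij : i j / (i <= j)%N.
  move=> H; case/orP: (leq_total i j) => /H//; rewrite distrC.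
  by rewrite [X in D * X]distrC.
have -> : `|i%:R * h - j%:R * h| = (j - i)%:R * h.
  rewrite distrC -mulrBl -natrB// ger0_norm ?mulr_ge0//.
rewrite -{1}(subnK ij); elim: (j - i)%N => [|d IH].
  by rewrite add0n subrr normr0 mul0r mulr0.
rewrite addSn distrC -natr1 mulrDl mul1r mulrDr.
rewrite -(subrKA (euler (d + i)).2) addrC.
apply: le_trans (ler_normD _ _) _; rewrite lerD//; first by rewrite distrC.
exact: euler2_step.
Qed.

Lemma euler1_lip i j : `|(euler i).1 - (euler j).1| <= B * `|i%:R * h - j%:R * h|.
Proof.
wlog ij : i j / (i <= j)%N.
  move=> H; case/orP: (leq_total i j) => /H//; rewrite distrC.
  by rewrite [X in B * X]distrC.
have -> : `|i%:R * h - j%:R * h| = (j - i)%:R * h.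
  rewrite distrC -mulrBl -natrB// ger0_norm ?mulr_ge0//.
rewrite -{1}(subnK ij); elim: (j - i)%N => [|d IH].
  by rewrite add0n subrr normr0 mul0r mulr0.
rewrite addSn distrC -natr1 mulrDl mul1r mulrDr.
rewrite -(subrKA (euler (d + i)).1) addrC.
apply: le_trans (ler_normD _ _) _; rewrite lerD//; first by rewrite distrC.
rewrite /= addrAC subrr add0r normrM (gtr0_norm h_gt0) mulrC ler_wpM2r ?euler2_le//.
Qed.

Lemma euler1_taylor j :
  `|(euler j).1 - a - j%:R * h * (euler 0).2| <= C * (j%:R * h) ^+ 2.
Proof.
elim: j => [|j IH]; first by rewrite /= !mul0r subrr subr0 normr0 expr0n mulr0.
have -> : (euler j.+1).1 - a - j.+1%:R * h * (euler 0).2 =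
  ((euler j).1 - a - j%:R * h * (euler 0).2) + h * ((euler j).2 - (euler 0).2).
  by rewrite -natr1 [(euler j.+1).1]/=; ring.
apply: le_trans (ler_normD _ _) _; rewrite normrM (gtr0_norm h_gt0).
have h1 : h * `|(euler j).2 - (euler 0).2| <= h * (C * (j%:R * h)).
  by rewrite ler_wpM2l ?euler2_dev.
apply: le_trans (lerD IH h1) _.
rewrite -natr1; move: j%:R (ler0n R j) => n n0.
have h2 : 0 <= C * h * (h * (n + 1)) by rewrite !mulr_ge0// ?addr_ge0.
rewrite -subr_ge0 (_ : _ - _ = C * h * (h * (n + 1))) //; ring.
Qed.

End euler_scheme.

Lemma ultra_bounded_cvg (R : realType) (T : Type) (U : set_system T)
    {UU : UltraFilter U} (x : T -> R) (M : R) :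
  (forall k, `|x k| <= M) -> exists l : R, x k @[k --> U] --> l.
Proof.
move=> xM.
have xU : UltraFilter (x @ U).
  split; first exact: fmap_proper_filter.
  move=> G PG sG; apply/seteqP; split => [A GA|A /sG//].
  have [//|UnA] := in_ultra_setVsetC (x @^-1` A) UU.
  have GnA : G (~` A) by apply: sG.
  have : G (A `&` ~` A) by exact: filterI.
  by rewrite setICr => /filter_not_empty.
have : compact (`[- M, M]%classic : set R) by exact: segment_compact.
rewrite compact_ultra => /(_ (x @ U) xU).
case; first by apply: (@filterE _ U) => k /=; rewrite in_itv/= -ler_norml.
by move=> l [_ xl]; exists l.
Qed.

Section grid_filter.
Context {R : realType}.
Variables (U : set_system nat) (UU : UltraFilter U) (Uoo : \oo `<=` U).

Definition step (k : nat) : R := k.+1%:R^-1.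

Definition gridpt (k : nat) (s : R) : nat := Num.truncn (s * k.+1%:R).

Lemma step_gt0 k : 0 < step k. Proof. by rewrite /step invr_gt0. Qed.

Lemma near_step (e : R) : 0 < e -> \forall k \near U, step k < e.
Proof.
by move=> e0; apply: Uoo; near=> k; near: k; exact: near_infty_natSinv_lt (PosNum e0).
Unshelve. all: by end_near.
Qed.

Lemma gridpt_itv k s : 0 <= s ->
  (gridpt k s)%:R * step k <= s < (gridpt k s)%:R * step k + step k.
Proof.
move=> s0; have := truncn_itv (mulr_ge0 s0 (ler0n R k.+1)); rewrite -/(gridpt k s).
rewrite -(ler_pM2r (step_gt0 k)) -[X in _ && X](ltr_pM2r (step_gt0 k)).
by rewrite mulfK ?pnatr_eq0// -[(gridpt k s).+1%:R]natr1 mulrDl mul1r.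
Qed.

Lemma dist_gridpt k s : 0 <= s -> `|(gridpt k s)%:R * step k - s| <= step k.
Proof.
move=> /(gridpt_itv k) /andP[h1 h2]; rewrite ler_norml; have := step_gt0 k; lra.
Qed.

(* The pair [(k, j)] stands for the node [j * step k] of the [k]-th grid. Gathering all
   nodes near [s] in one filter makes the limit rules applicable to the scheme. *)
Definition grid_nbhs (s : R) : set_system (nat * nat) :=
  [set A | exists2 d : R, 0 < d &
    \forall k \near U, forall j, `|j%:R * step k - s| <= d -> A (k, j)].

Lemma grid_nbhs_filter s : 0 <= s -> ProperFilter (grid_nbhs s).
Proof.
move=> s0; split.
  move=> [d d0 h].
  suff : \forall k \near U, False by move/(@filter_not_empty _ U).
  apply: (filterS2 _ _ h (near_step _ d0)) => k h1 h2.
  apply: (h1 (gridpt k s)); apply: le_trans (ltW h2); exact: dist_gridpt.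
split.
- by exists 1 => //; apply: filterE.
- move=> A B [d d0 hA] [e e0 hB]; exists (Num.min d e); first by rewrite lt_min d0.
  near=> k => j; rewrite le_min => /andP[jd je]; split.
    by move: j jd {je}; near: k.
  by move: j je {jd}; near: k.
- move=> A B AB [d d0 hA]; exists d => //; near=> k => j jd; apply: AB.
  by move: j jd; near: k.
Unshelve. all: by end_near.
Qed.

Lemma grid_nbhs_pt (s : R) (h0 : 0 <= s) :
  z.2%:R * step z.1 @[z --> grid_nbhs s] --> s.
Proof.
have := grid_nbhs_filter _ h0 => ?.
apply/cvgrPdist_le => e e0; exists e => //; apply: filterE => k j /=.
by rewrite distrC.
Qed.

Lemma grid_nbhs_step (s : R) (h0 : 0 <= s) : step z.1 @[z --> grid_nbhs s] --> 0.
Proof.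
have := grid_nbhs_filter _ h0 => ?.
apply/cvgrPdist_le => e e0; exists 1 => //.
apply: (@filterS _ U _ _ _ _ (near_step _ e0)) => k ke j _.
by rewrite sub0r normrN /= ger0_norm ltW// step_gt0.
Qed.

Lemma cvg_gridpt (s : R) (h0 : 0 <= s) :
  (gridpt k s)%:R * step k @[k --> U] --> s.
Proof.
apply/cvgrPdist_le => e e0; apply: (@filterS _ U _ _ _ _ (near_step _ e0)) => k ke.
by rewrite distrC (le_trans (dist_gridpt _ _ h0))// ltW.
Qed.

Lemma grid_nbhs_cvg (x : nat -> nat -> R) (X : R -> R) (D s : R) (s0 : 0 <= s) :
  (forall k i j, `|x k i - x k j| <= D * `|i%:R * step k - j%:R * step k|) ->
  x k (gridpt k s) @[k --> U] --> X s ->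
  x z.1 z.2 @[z --> grid_nbhs s] --> X s.
Proof.
move=> xD xX; have := grid_nbhs_filter _ s0 => ?.
have D0 : 0 <= D.
  have := xD 0%N 1%N 0%N; rewrite mul0r subr0 mul1r /step invr1 normr1 mulr1.
  by apply: le_trans.
apply/cvgrPdist_le => e e0.
have De : 0 < e / 2 / 2 / (D + 1) by rewrite !divr_gt0// ltr_wpDl.
exists (e / 2 / 2 / (D + 1)) => //.
have e20 : 0 < e / 2 by rewrite divr_gt0.
move/cvgrPdist_le : xX => /(_ _ e20) H.
apply: (filterS2 _ _ H (near_step _ De)) => k h1 h2 j h3.
rewrite -(subrKA (x k (gridpt k s))).
apply: le_trans (ler_normD _ _) _; rewrite [leRHS](splitr e) lerD//.
apply: le_trans (xD _ _ _) _.
have h4 : `|(gridpt k s)%:R * step k - j%:R * step k| <= e / 2 / (D + 1).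
  rewrite -(subrKA s) (le_trans (ler_normD _ _))//.
  have := dist_gridpt k _ s0; rewrite [`|s - _|]distrC => h5.
  have -> : e / 2 / (D + 1) = e / 2 / 2 / (D + 1) + e / 2 / 2 / (D + 1).
    by rewrite -mulrDl -splitr.
  by rewrite lerD// (le_trans h5)// ltW.
apply: le_trans (ler_wpM2l D0 h4) _.
rewrite mulrCA -[leRHS]mulr1 ler_wpM2l ?divr_ge0 ?ltW//.
by rewrite ltr_pdivrMr ?ltr_wpDl// mul1r ltrDl.
Qed.

Lemma grid_derive (x q : nat -> nat -> R) (X : R -> R) (s Q : R) :
  0 < s ->
  (forall k j, x k j.+1 = x k j + step k * q k j) ->
  (forall r, 0 <= r -> x k (gridpt k r) @[k --> U] --> X r) ->
  q z.1 z.2 @[z --> grid_nbhs s] --> Q ->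
  is_derive s 1 X Q.
Proof.
move=> s0 xq xX qQ; have := grid_nbhs_filter _ (ltW s0) => ?.
have key e : 0 < e -> exists2 d : R, 0 < d & forall r r', 0 <= r -> r <= r' ->
    `|r - s| <= d -> `|r' - s| <= d -> `|X r' - X r - (r' - r) * Q| <= e * (r' - r).
  move=> e0; move/cvgrPdist_le : qQ => /(_ _ e0) [d d0 H].
  exists (d / 2); first by rewrite divr_gt0.
  move=> r r' r0 rr' rd r'd; have r'0 := le_trans r0 rr'.
  have L1 := xX _ r0; have L2 := xX _ r'0.
  have L3 := cvg_gridpt _ r0; have L4 := cvg_gridpt _ r'0.
  have d20 : 0 < d / 2 by rewrite divr_gt0.
  have main : \forall k \near U,
    `|x k (gridpt k r') - x k (gridpt k r)
        - ((gridpt k r')%:R * step k - (gridpt k r)%:R * step k) * Q|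
     <= e * ((gridpt k r')%:R * step k - (gridpt k r)%:R * step k).
    apply: (filterS2 _ _ H (near_step _ d20)) => k {}H kd.
    have gg : (gridpt k r <= gridpt k r')%N.
      by rewrite /gridpt le_truncn// ler_wpM2r.
    have bnd i : (gridpt k r <= i <= gridpt k r')%N -> `|i%:R * step k - s| <= d.
      move=> /andP[i1 i2].
      have := gridpt_itv k _ r0; have := gridpt_itv k _ r'0.
      move: rd r'd; rewrite !ler_norml => /andP[? ?] /andP[? ?] /andP[? ?] /andP[? ?].
      have : (gridpt k r)%:R * step k <= i%:R * step k.
        by rewrite ler_pM2r ?step_gt0// ler_nat.
      have : i%:R * step k <= (gridpt k r')%:R * step k.
        by rewrite ler_pM2r ?step_gt0// ler_nat.
      by move=> ? ?; apply/andP; split; lra.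
    suff : forall m, (gridpt k r + m <= gridpt k r')%N ->
      `|x k (gridpt k r + m)%N - x k (gridpt k r) - m%:R * step k * Q|
        <= e * (m%:R * step k).
      move=> /(_ (gridpt k r' - gridpt k r)%N); rewrite subnKC// => /(_ (leqnn _)).
      by rewrite natrB// mulrBl.
    elim=> [|m IH] hm.
      by rewrite addn0 subrr !mul0r subr0 normr0 mulr0.
    rewrite addnS xq -natr1.
    have -> : x k (gridpt k r + m)%N + step k * q k (gridpt k r + m)%N - x k (gridpt k r)
       - (m%:R + 1) * step k * Q =
       (x k (gridpt k r + m)%N - x k (gridpt k r) - m%:R * step k * Q)
        - step k * (Q - q k (gridpt k r + m)%N) by ring.
    apply: le_trans (ler_normB _ _) _; rewrite normrM (gtr0_norm (step_gt0 k)).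
    have h1 : step k * `|Q - q k (gridpt k r + m)%N| <= step k * e.
      rewrite ler_wpM2l ?(ltW (step_gt0 k))//.
      by apply: H; apply: bnd; rewrite leq_addr/= (leq_trans _ hm)// addnS.
    apply: le_trans (lerD (IH _) h1) _; first by rewrite (leq_trans _ hm)// addnS.
    by rewrite le_eqVlt; apply/orP; left; apply/eqP; ring.
  have cl : `|x k (gridpt k r') - x k (gridpt k r)
        - ((gridpt k r')%:R * step k - (gridpt k r)%:R * step k) * Q| @[k --> U]
        --> `|X r' - X r - (r' - r) * Q|.
    apply: cvg_norm; apply: cvgB; first exact: cvgB.
    by apply: cvgMr_tmp; exact: cvgB.
  have cr : e * ((gridpt k r')%:R * step k - (gridpt k r)%:R * step k) @[k --> U]
        --> e * (r' - r).
    by apply: cvgMl_tmp; exact: cvgB.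
  exact: ler_cvg_to cl cr main.
suff H : h^-1 *: (X (h *: 1 + s) - X s) @[h --> 0^'] --> Q.
  by split; [apply/cvg_ex; exists Q | apply/cvg_lim].
apply/cvgrPdist_le => e e0; have [d d0 Hd] := key _ e0.
near=> h.
have h0 : h != 0 by near: h; exact: nbhs_dnbhs_neq.
have hd : `|h| <= Num.min d s.
  near: h; apply: dnbhs0_le; by rewrite lt_min d0.
rewrite scaler1 /GRing.scale /=.
have -> : Q - h^-1 * (X (h + s) - X s) = - (h^-1 * (X (h + s) - X s - h * Q)).
  by field.
rewrite normrN normrM normfV ler_pdivrMl ?normr_gt0// [leRHS]mulrC.
move: hd; rewrite le_min => /andP[hd hs].
have [hp|hn] := leP 0 h.
  have := Hd s (h + s); rewrite lerDr addrK subrr normr0 (ltW s0) (ltW d0) hp hd.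
  by rewrite (ger0_norm hp); exact.
have := Hd (h + s) s; rewrite gerDr addrK subrr normr0 (ltW hn) (ltW d0) hd.
have -> : X s - X (h + s) - (s - (h + s)) * Q = - (X (h + s) - X s - h * Q) by ring.
have -> : s - (h + s) = - h by ring.
rewrite normrN (ltr0_norm hn) => H; apply: H => //.
by move: hs; rewrite (ltr0_norm hn); lra.
Unshelve. all: by end_near.
Qed.

End grid_filter.

Lemma dist_max0 (R : realDomainType) (s r : R) :
  `|Num.max 0 s - Num.max 0 r| <= `|s - r|.
Proof.
have h1 : s - r <= `|s - r| by exact: ler_norm.
have h2 : r - s <= `|s - r| by rewrite distrC; exact: ler_norm.
rewrite ler_norml; apply/andP.
by have [h3|h3] := leP 0 s; have [h4|h4] := leP 0 r; split; lra.
Qed.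

Section existence.
Context {R : realType}.
Variables (f : R -> R) (a N M L : R).
Hypotheses (N_gt0 : 0 < N) (L_ge0 : 0 <= L) (f_cont : continuous f).
Hypothesis f_bounded : forall x, `|f x| <= M.
Hypothesis f_lip : forall x, `|f x - f a| <= L * `|x - a|.

Lemma radial_ode_exists : exists W Y : R -> R,
  [/\ W 0 = a, Y 0 = - f a / N, continuous Y,
      forall s : R, is_derive s 1 W (Y s)
    & forall s : R, 0 < s ->
        is_derive s 1 Y (- ((N + s) * Y s + f (W s)) / (4 * s))].
Proof.
have [U [UU Uoo]] := ultraFilterLemma (@eventually_filter).
pose B := M / N; pose C := (L + 1) * B / N.
pose D := (N * C + 2 * B + (L + 1) * B) / 4.
have B_ge : M <= N * B by rewrite /B [leRHS]mulrC divfK// gt_eqF.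
have C_ge : (L + 1) * B <= N * C by rewrite /C [leRHS]mulrC divfK// gt_eqF.
have D_ge : N * C + 2 * B + (L + 1) * B <= 4 * D by rewrite /D [leRHS]mulrC divfK.
clearbody B C D.
pose w k j := (euler f a N (step k) j).1.
pose y k j := (euler f a N (step k) j).2.
pose y0 := - f a / N.
have h0 k : 0 < step k :> R := step_gt0 k.
have wB k j : `|w k j - a| <= B * (j%:R * step k).
  exact: (euler1_le f a N M B (step k) N_gt0 (h0 k) f_bounded B_ge j).
have yB k j : `|y k j| <= B by exact: (euler2_le f a N M B (step k) N_gt0 (h0 k) f_bounded B_ge j).
have y_lip k i j : `|y k i - y k j| <= D * `|i%:R * step k - j%:R * step k|.
  exact: (euler2_lip f a N M L B C D (step k) N_gt0 (h0 k) L_ge0 f_bounded f_lip B_ge C_ge D_ge).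
have w_lip k i j : `|w k i - w k j| <= B * `|i%:R * step k - j%:R * step k|.
  exact: (euler1_lip f a N M B (step k) N_gt0 (h0 k) f_bounded B_ge).
have B0 : 0 <= B by exact: le_trans (yB 0%N 0%N).
have ylim (s : R) : exists l : R, y k (gridpt k s) @[k --> U] --> l.
  by apply: (ultra_bounded_cvg _ _ U _ B) => k.
have wlim (s : R) : exists l : R, w k (gridpt k s) @[k --> U] --> l.
  have [s0|s0] := leP 0 s; last first.
    exists a; apply: cvg_near_cst; apply: filterE => k.
    rewrite /w /gridpt truncn_floor ifF//; apply/negbTE.
    by rewrite -ltNge pmulr_llt0// ltr0n.
  apply: (ultra_bounded_cvg _ _ U _ (`|a| + B * s)) => k.
  rewrite -(subrK a (w _ _)) addrC; apply: le_trans (ler_normD _ _) _.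
  rewrite lerD2l; apply: le_trans (wB _ _) _; rewrite ler_wpM2l//.
  by have /andP[] := gridpt_itv k s s0.
pose Y0 s := sval (cid (ylim s)); pose W0 s := sval (cid (wlim s)).
have Ylim s : y k (gridpt k s) @[k --> U] --> Y0 s := svalP (cid (ylim s)).
have Wlim s : w k (gridpt k s) @[k --> U] --> W0 s := svalP (cid (wlim s)).
have grid0 k : gridpt k (0 : R) = 0%N by rewrite /gridpt mul0r truncn0.
have Y00 : Y0 0 = y0.
  apply: (cvg_unique _ (Ylim 0)); first exact: Rhausdorff.
  by apply: cvg_near_cst; apply: filterE => k; rewrite grid0.
have W00 : W0 0 = a.
  apply: (cvg_unique _ (Wlim 0)); first exact: Rhausdorff.
  by apply: cvg_near_cst; apply: filterE => k; rewrite grid0.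
have W_taylor (s : R) : 0 <= s -> `|W0 s - a - s * y0| <= C * s ^+ 2.
  move=> s0.
  have c1 : `|w k (gridpt k s) - a - (gridpt k s)%:R * step k * y0| @[k --> U]
      --> `|W0 s - a - s * y0|.
    apply: cvg_norm; apply: cvgB; first by apply: cvgB => //; exact: cvg_cst.
    by apply: cvgMr_tmp; exact: cvg_gridpt.
  have c2 : C * ((gridpt k s)%:R * step k) ^+ 2 @[k --> U] --> C * s ^+ 2.
    by apply: cvgMl_tmp; rewrite expr2; apply: cvgM; exact: cvg_gridpt.
  apply: (ler_cvg_to c1 c2); apply: filterE => k.
  exact: (euler1_taylor f a N M L B C (step k) N_gt0 (h0 k) L_ge0 f_bounded f_lip B_ge C_ge).
have Y_lip (s r : R) : 0 <= s -> 0 <= r -> `|Y0 s - Y0 r| <= D * `|s - r|.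
  move=> s0 r0.
  have c1 : `|y k (gridpt k s) - y k (gridpt k r)| @[k --> U] --> `|Y0 s - Y0 r|.
    by apply: cvg_norm; exact: cvgB.
  have c2 : D * `|(gridpt k s)%:R * step k - (gridpt k r)%:R * step k| @[k --> U]
      --> D * `|s - r|.
    by apply: cvgMl_tmp; apply: cvg_norm; apply: cvgB; exact: cvg_gridpt.
  by apply: (ler_cvg_to c1 c2); apply: filterE => k.
have W_der (s : R) : 0 < s -> is_derive s 1 W0 (Y0 s).
  move=> s0; apply: (grid_derive U _ _ w y) => //.
  exact: (grid_nbhs_cvg U UU Uoo y Y0 D s (ltW s0) y_lip (Ylim s)).
pose q k j := 4 * y k j - (N + j.+1%:R * step k) * y k j.+1 - f (w k j).
have q_cvg (s : R) : 0 < s ->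
    q z.1 z.2 @[z --> grid_nbhs U s] --> 4 * Y0 s - (N + s) * Y0 s - f (W0 s).
  move=> /ltW s0; have := grid_nbhs_filter U UU Uoo s s0 => FF.
  have yc : y z.1 z.2 @[z --> grid_nbhs U s] --> Y0 s.
    exact: (grid_nbhs_cvg U UU Uoo y Y0 D s s0 y_lip (Ylim s)).
  have wc : w z.1 z.2 @[z --> grid_nbhs U s] --> W0 s.
    exact: (grid_nbhs_cvg U UU Uoo w W0 B s s0 w_lip (Wlim s)).
  have hc : step z.1 @[z --> grid_nbhs U s] --> (0 : R).
    exact: grid_nbhs_step.
  have sc : z.2.+1%:R * step z.1 @[z --> grid_nbhs U s] --> s.
    rewrite -[X in _ --> X]addr0.
    under eq_fun do rewrite -natr1 mulrDl mul1r.
    by apply: cvgD => //; exact: grid_nbhs_pt.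
  have y1c : y z.1 z.2.+1 @[z --> grid_nbhs U s] --> Y0 s.
    rewrite -[X in _ --> X]addr0.
    under eq_fun => z do rewrite -[y z.1 z.2.+1](subrK (y z.1 z.2)) addrC.
    apply: cvgD => //; apply/norm_cvg0P.
    apply: (@squeeze_cvgr _ _ _ _ (fun=> 0) (fun z => D * step z.1)).
    - apply: filterE => z; rewrite normr_ge0/=.
      apply: le_trans (y_lip _ _ _) _.
      by rewrite -mulrBl -natrB// subSnn mul1r ger0_norm// ltW.
    - exact: cvg_cst.
    - by rewrite -(mulr0 D); apply: cvgMl_tmp.
  apply: cvgB.
    apply: cvgB; first exact: cvgMl_tmp.
    by apply: cvgM => //; apply: cvgD => //; exact: cvg_cst.
  by apply: (cvg_comp _ _ wc); exact: f_cont.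
have P_der (s : R) : 0 < s ->
    is_derive s 1 (fun r => 4 * r * Y0 r) (4 * Y0 s - (N + s) * Y0 s - f (W0 s)).
  move=> s0; apply: (grid_derive U _ _ (fun k j => 4 * (j%:R * step k) * y k j) q) => //.
  - move=> k j; rewrite /q.
    have E := eulerS2 f a N (step k) N_gt0 (h0 k) j.
    rewrite -[y k j.+1]/(_.2) -[y k j]/(_.2) -[w k j]/(_.1).
    set v := (euler _ _ _ _ j).2 in E *; set v1 := (euler _ _ _ _ j.+1).2 in E *.
    set u := f _ in E *.
    have -> : u = - (N + j.+1%:R * step k) * v1 - 4 * j.+1%:R * (v1 - v).
      by rewrite E; ring.
    by rewrite -natr1; ring.
  - move=> r r0; apply: cvgM => //; apply: cvgMl_tmp; exact: cvg_gridpt.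
  - exact: q_cvg.
have Y_der (s : R) : 0 < s -> is_derive s 1 Y0 (- ((N + s) * Y0 s + f (W0 s)) / (4 * s)).
  move=> s0.
  have s40 : 4 * s != 0 by rewrite mulf_neq0// gt_eqF.
  have := P_der _ s0 => HP.
  have H4 := der_cmul 4 _ _ _ (der_id s).
  have H := der_mul _ _ _ _ _ HP (der_inv _ _ _ s40 H4).
  apply: (der_near (fun r : R => 4 * r * Y0 r * (4 * r)^-1)); last first.
    by apply: derE H; field; rewrite gt_eqF.
  near=> r.
  have r0 : 0 < r by near: r; exact: lt_nbhsr.
  by rewrite mulrAC divff ?mul1r// mulf_neq0// gt_eqF.
pose W s := if 0 <= s then W0 s else a + s * y0.
exists W, (fun s => Y0 (Num.max 0 s)); split.
- by rewrite /W lexx.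
- by rewrite maxxx.
- move=> s; apply/cvgrPdist_le => e e0.
  have D0 : 0 <= D.
    have := Y_lip 1 0; rewrite ler01 lexx subr0 normr1 mulr1.
    by move=> /(_ isT isT); apply: le_trans.
  have De : 0 < e / (D + 1) by rewrite divr_gt0// ltr_wpDl.
  have /cvgrPdist_le/(_ _ De) HN : (fun r : R => r) @ s --> s by exact: cvg_id.
  near=> r.
  apply: (@le_trans _ _ (D * `|s - r|)).
    apply: le_trans (Y_lip _ _ _ _) _; rewrite ?le_max ?lexx//.
    rewrite ler_wpM2l//.
    exact: dist_max0.
  have H : `|s - r| <= e / (D + 1).
    by near: r.
  apply: le_trans (ler_wpM2l D0 H) _.
  rewrite mulrCA -[leRHS]mulr1 ler_wpM2l ?ltW//.
  by rewrite ltr_pdivrMr ?ltr_wpDl// mul1r ltrDl.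
- move=> s; have [s0|s0|->] := ltgtP s 0.
  + rewrite Y00.
    apply: (der_near (fun r : R => a + r * y0)).
    * near=> r; rewrite /W leNgt ifF//; apply/negbTE; rewrite negbK.
      by near: r; exact: lt_nbhsl.
    * apply: derE (der_add _ _ _ _ _ (der_cst a s)
        (der_mul _ _ _ _ _ (der_id s) (der_cst y0 s))); ring.
  + apply: (der_near W0); last exact: W_der.
    near=> r; rewrite /W ifT// ltW//.
    by near: r; exact: lt_nbhsr.
  + rewrite Y00.
    suff H : h^-1 *: (W (h *: 1 + 0) - W 0) @[h --> 0^'] --> y0.
      by split; [apply/cvg_ex; exists y0 | apply/cvg_lim].
    have C0 : 0 <= C.
      have := W_taylor 1 ler01; rewrite expr1n mulr1.
      by apply: le_trans.
    apply/cvgrPdist_le => e e0.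
    have Ce : 0 < e / (C + 1) by rewrite divr_gt0// ltr_wpDl.
    near=> h.
    have hn0 : h != 0 by near: h; exact: nbhs_dnbhs_neq.
    have hd : `|h| <= e / (C + 1) by near: h; exact: dnbhs0_le.
    rewrite scaler1 addr0 /GRing.scale /= {2}/W lexx W00.
    have -> : y0 - h^-1 * (W h - a) = - (h^-1 * (W h - a - h * y0)) by field.
    rewrite normrN normrM normfV ler_pdivrMl ?normr_gt0// [leRHS]mulrC.
    rewrite /W; case: (leP 0 h) => hp; last first.
      by rewrite [a + _]addrC addrK subrr normr0 mulr_ge0// ltW.
    apply: le_trans (W_taylor _ hp) _; rewrite (ger0_norm hp) expr2 mulrA.
    rewrite ler_wpM2r//; move: hd; rewrite (ger0_norm hp) => hd.
    apply: le_trans (ler_wpM2l C0 hd) _.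
    rewrite mulrCA -[leRHS]mulr1 ler_wpM2l ?ltW//.
    by rewrite ltr_pdivrMr ?ltr_wpDl// mul1r ltrDl.
- move=> s s0; rewrite (max_idPr (ltW s0)) /W (ltW s0).
  apply: (der_near Y0); last exact: Y_der.
  near=> r; rewrite (max_idPr _)// ltW//.
  by near: r; exact: lt_nbhsr.
Unshelve. all: by end_near.
Qed.

End existence.

(** * The nonlinearity *)

Definition spow {R : realType} (p w : R) : R := w * `|w| `^ (p - 1).

Definition force {R : realType} (p w : R) : R := spow p w - (1 - p)^-1 * w.

Definition potential {R : realType} (p w : R) : R :=
  `|w| `^ (p + 1) / (p + 1) - (1 - p)^-1 * w ^+ 2 / 2.

Section nonlinearity.
Context {R : realType}.
Variables (p : R).
Hypotheses (p_gt0 : 0 < p) (p_lt1 : p < 1).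
Implicit Types (w x a r : R).

Lemma spowN w : spow p (- w) = - spow p w.
Proof. by rewrite /spow normrN mulNr. Qed.

Lemma forceN w : force p (- w) = - force p w.
Proof. by rewrite /force spowN mulrN opprD. Qed.

Lemma spow_ge0 w : 0 <= w -> spow p w = w `^ p.
Proof. by move=> w0; rewrite /spow ger0_norm// mulr_powRB1. Qed.

Lemma norm_spow w : `|spow p w| = `|w| `^ p.
Proof. by rewrite /spow normrM (ger0_norm (powR_ge0 _ _)) mulr_powRB1. Qed.

Lemma mul_spow w : w * spow p w = `|w| `^ (p + 1).
Proof.
rewrite /spow mulrA -expr2 -real_normK ?num_real//.
have [->|w0] := eqVneq w 0.
  by rewrite normr0 expr0n mul0r powR0// gt_eqF// addr_gt0.
rewrite -powR_mulrn// -powRD; last by rewrite normr_eq0 w0 implybT.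
by congr (_ `^ _); ring.
Qed.

Lemma sqr_powR w : w ^+ 2 = `|w| `^ (1 - p) * `|w| `^ (p + 1).
Proof.
have E : 1 - p + (p + 1) = 2%:R :> R by ring.
rewrite -powRD E ?pnatr_eq0//.
by rewrite powR_mulrn// real_normK ?num_real.
Qed.

Lemma le_powR r x a : 0 <= r -> 0 <= x -> x <= a -> x `^ r <= a `^ r.
Proof.
by move=> r0 x0 xa; apply: ge0_ler_powR; rewrite ?nnegrE// (le_trans x0).
Qed.

Lemma near0_powR r : 0 < r -> forall e : R, 0 < e ->
  exists2 d : R, 0 < d & forall w, `|w| <= d -> `|w| `^ r <= e.
Proof.
move=> r0 e e0; exists (e `^ r^-1); first exact: powR_gt0.
move=> w wd; apply: le_trans (ge0_ler_powR (ltW r0) _ _ wd) _.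
- by rewrite nnegrE.
- by rewrite nnegrE powR_ge0.
- by rewrite -powRrM mulVf ?gt_eqF// powRr1// ltW.
Qed.

Lemma near_normr_le (x : R) (d : R) : 0 < d -> \forall r \near x, `|r - x| <= d.
Proof.
move=> d0; have /cvgrPdist_le/(_ _ d0) : (fun r : R => r) @ x --> x by exact: cvg_id.
by apply: filterS => r; rewrite distrC.
Qed.

Lemma spow_continuous : continuous (spow p).
Proof.
have pos w : 0 < w -> {for w, continuous (spow p)}.
  move=> w0; apply: (der_continuous _ _ (p * w `^ (p - 1))).
  apply: (der_near (fun r : R => r `^ p)); last exact: is_derive1_powR.
  near=> r; rewrite spow_ge0// ltW//; near: r; exact: lt_nbhsr.
move=> w; have [w0|w0|->] := ltgtP w 0.
- have H : {for w, continuous (fun r => - spow p (- r))}.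
    apply: (@continuous_comp _ _ _ (fun r => - r) (fun r => - spow p r)).
      exact: opp_continuous.
    apply: (@continuous_comp _ _ _ (spow p) (fun r => - r)).
      by apply: pos; rewrite oppr_gt0.
    exact: opp_continuous.
  suff -> : spow p = (fun r : R => - spow p (- r)) by [].
  by apply/funext => r; rewrite spowN opprK.
- exact: pos.
- apply/cvgrPdist_le => e e0; have [d d0 H] := near0_powR _ p_gt0 _ e0.
  apply: filterS (near_normr_le 0 _ d0) => r.
  rewrite [spow p 0]/spow mul0r subr0 sub0r normrN => /H; apply: le_trans.
  by rewrite norm_spow.
Unshelve. all: by end_near.
Qed.

Lemma force_continuous : continuous (force p).
Proof.
move=> w; apply: cvgB; first exact: spow_continuous.
by apply: cvgMl_tmp; exact: cvg_id.
Qed.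

Lemma der_powR_norm w : is_derive w 1 (fun x : R => `|x| `^ (p + 1)) ((p + 1) * spow p w).
Proof.
have pos x : 0 < x -> is_derive x 1 (fun x : R => `|x| `^ (p + 1)) ((p + 1) * spow p x).
  move=> x0; apply: (der_near (fun r : R => r `^ (p + 1))).
    near=> r; rewrite ger0_norm// ltW//; near: r; exact: lt_nbhsr.
  by rewrite spow_ge0 ?ltW//; apply: derE (is_derive1_powR _ x0); rewrite addrK.
have [w0|w0|->] := ltgtP w 0.
- have wn : 0 < - w by rewrite oppr_gt0.
  apply: (der_near (fun x : R => `|- x| `^ (p + 1))).
    by apply: filterE => r; rewrite normrN.
  have := der_comp _ _ _ _ _ (pos _ wn) (is_deriveN (der_id w)).
  by apply: derE; rewrite spowN; ring.
- exact: pos.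
- apply: der_of_le => e e0; have [d d0 H] := near0_powR _ p_gt0 _ e0.
  exists d => // h hd.
  have p1 : p + 1 != 0 by rewrite gt_eqF// addr_gt0.
  rewrite add0r /spow mul0r !mulr0 subr0 normr0 powR0// subr0 ger0_norm ?powR_ge0//.
  rewrite -mul_spow -[h * _]ger0_norm; last by rewrite mul_spow powR_ge0.
  by rewrite normrM mulrC ler_wpM2r// norm_spow H.
Unshelve. all: by end_near.
Qed.

Lemma der_potential w : is_derive w 1 (potential p) (force p w).
Proof.
have p1 : p + 1 != 0 by rewrite gt_eqF// addr_gt0.
have H1 := der_cmul (p + 1)^-1 _ _ _ (der_powR_norm w).
have H2 := der_cmul ((1 - p)^-1 / 2) _ _ _ (der_sqr _ _ _ (der_id w)).
have := der_sub _ _ _ _ _ H1 H2.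
rewrite (_ : potential p = fun x => (p + 1)^-1 * `|x| `^ (p + 1) - (1 - p)^-1 / 2 * x ^+ 2).
  apply: derE; rewrite /force mulKf//; congr (_ - _); field.
  by rewrite subr_eq0 eq_sym lt_eqF.
by apply/funext => x; rewrite /potential mulrC; congr (_ - _); rewrite mulrAC.
Qed.

Lemma potential_norm w : potential p `|w| = potential p w.
Proof. by rewrite /potential normr_id real_normK ?num_real. Qed.

Definition clamp a x := Num.max (- a) (Num.min x a).

Lemma clamp_id a x : `|x| <= a -> clamp a x = x.
Proof.
by rewrite ler_norml => /andP[h1 h2]; rewrite /clamp (min_idPl h2) (max_idPr h1).
Qed.

Lemma clamp_le a x : 0 <= a -> `|clamp a x| <= a.
Proof.
move=> a0; rewrite ler_norml /clamp le_max lexx/= ge_max ge_min lexx orbT andbT.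
by lra.
Qed.

Lemma clamp_continuous a : continuous (clamp a).
Proof.
move=> x.
have c1 : {for x, continuous ((fun y : R => y) \min (fun=> a))}.
  by apply: continuous_min; [exact: cvg_id|exact: cvg_cst].
have c2 : {for x, continuous (fun=> - a : R)} by exact: cvg_cst.
exact: (continuous_max c2 c1).
Qed.

Lemma powR_opp_exp_le a x : 0 <= x <= a -> x * a `^ (p - 1) <= x `^ p.
Proof.
move=> /andP[]; rewrite le_eqVlt => /predU1P[<- _|x0 xa].
  by rewrite mul0r powR_ge0.
rewrite -(mulr_powRB1 (ltW x0) p_gt0) ler_pM2l//.
rewrite -opprB !powRN lef_pV2 ?posrE ?powR_gt0 ?(lt_le_trans x0)//.
by apply: le_powR => //; [rewrite subr_ge0 ltW|exact: ltW].
Qed.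

Lemma spow_lip a x : 0 < a -> `|x| <= a ->
  `|spow p x - spow p a| <= 2 * a `^ (p - 1) * `|x - a|.
Proof.
move=> a0; rewrite ler_norml => /andP[xa1 xa].
rewrite distrC [`|x - a|]distrC (ger0_norm (_ : 0 <= a - x)); last by rewrite subr_ge0.
have aE : spow p a = a * a `^ (p - 1) by rewrite /spow gtr0_norm.
have b0 := powR_ge0 a (p - 1).
have [x0|x0] := leP 0 x.
  have := powR_opp_exp_le a x; rewrite x0 xa => /(_ isT) h1.
  rewrite (spow_ge0 x x0) ger0_norm; last first.
    rewrite subr_ge0 (spow_ge0 a (ltW a0)).
    by apply: le_powR => //; exact: ltW.
  rewrite aE; have : 0 <= (a - x) * a `^ (p - 1) by rewrite mulr_ge0// subr_ge0.
  lra.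
have nx0 : 0 <= - x by rewrite oppr_ge0 ltW.
have -> : spow p x = - (- x) `^ p by rewrite -spow_ge0// spowN opprK.
have h1 : (- x) `^ p <= a * a `^ (p - 1).
  rewrite -aE spow_ge0 ?(ltW a0)//; apply: le_powR => //; [exact: ltW|lra].
rewrite opprK ger0_norm ?addr_ge0 ?powR_ge0//; last by rewrite aE mulr_ge0// ltW.
rewrite aE; have : 0 <= - x * a `^ (p - 1) by rewrite mulr_ge0.
lra.
Qed.

Section below_equilibrium.
Variable a : R.
Hypotheses (a_gt0 : 0 < a) (a_lt : (1 - p)^-1 * a `^ (1 - p) < 1).

(* Freezing [force] outside [[- a, a]] makes it bounded; solutions starting at [a]
   never leave this interval. *)
Definition cforce x := force p (clamp a x).

Lemma cforceE x : `|x| <= a -> cforce x = force p x.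
Proof. by move=> xa; rewrite /cforce clamp_id. Qed.

Lemma cforce_continuous : continuous cforce.
Proof.
move=> x; apply: (@continuous_comp _ _ _ (clamp a) (force p)); first exact: clamp_continuous.
exact: force_continuous.
Qed.

Let m_gt0 : 0 < (1 - p)^-1. Proof. by rewrite invr_gt0 subr_gt0. Qed.

Lemma cforce_lip x : `|cforce x - cforce a| <=
  (2 * a `^ (p - 1) + (1 - p)^-1) * `|x - a|.
Proof.
have aa : `|a| <= a by rewrite gtr0_norm.
rewrite (cforceE a aa) /cforce.
have c1 := clamp_le a x (ltW a_gt0).
have c2 : `|clamp a x - a| <= `|x - a|.
  move: c1; rewrite ler_norml => /andP[c11 c12].
  rewrite distrC [leRHS]distrC ger0_norm ?subr_ge0//.
  rewrite /clamp; have h1 := ler_norm (a - x); have h2 := normr_ge0 (a - x).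
  have [h3|h3] := leP x a.
    by have [h4|h4] := leP (- a) x; lra.
  by have [h4|h4] := leP (- a) a; lra.
have -> : force p (clamp a x) - force p a = (spow p (clamp a x) - spow p a)
   - (1 - p)^-1 * (clamp a x - a) by rewrite /force; ring.
apply: le_trans (ler_normB _ _) _; rewrite mulrDl lerD//.
  apply: le_trans (spow_lip _ _ a_gt0 c1) _.
  by rewrite ler_wpM2l// mulr_ge0// powR_ge0.
by rewrite normrM gtr0_norm// ler_pM2l.
Qed.

Lemma cforce_bounded x : `|cforce x| <= a `^ p + (1 - p)^-1 * a.
Proof.
have c1 := clamp_le a x (ltW a_gt0).
apply: le_trans (ler_normB _ _) _; rewrite lerD//.
  rewrite norm_spow.
  by apply: le_powR => //; exact: ltW.
by rewrite normrM gtr0_norm// ler_pM2l.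
Qed.

Let m_powR_le w : `|w| <= a ->
  (1 - p)^-1 * `|w| `^ (1 - p) <= (1 - p)^-1 * a `^ (1 - p).
Proof.
move=> wa; rewrite ler_pM2l//; apply: le_powR => //.
by rewrite subr_ge0 ltW.
Qed.

Lemma mul_force_ge w : `|w| <= a ->
  (1 - (1 - p)^-1 * a `^ (1 - p)) * `|w| `^ (p + 1) <= w * force p w.
Proof.
move=> /m_powR_le wa; rewrite /force mulrBr mul_spow mulrCA -expr2 sqr_powR mulrA.
by rewrite mulrBl mul1r lerD2l lerN2 ler_wpM2r// powR_ge0.
Qed.

Lemma potential_ge w : `|w| <= a ->
  ((p + 1)^-1 - 2^-1) * `|w| `^ (p + 1) <= potential p w.
Proof.
move=> /m_powR_le wa; rewrite /potential sqr_powR mulrBl mulrC lerD2l lerN2.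
have : (1 - p)^-1 * `|w| `^ (1 - p) * `|w| `^ (p + 1) <= 1 * `|w| `^ (p + 1).
  by rewrite ler_wpM2r ?powR_ge0// (le_trans wa)// ltW.
rewrite -mulrA; lra.
Qed.

Lemma potential_le w : potential p w <= `|w| `^ (p + 1).
Proof.
rewrite /potential lerBlDr.
have h1 : `|w| `^ (p + 1) / (p + 1) <= `|w| `^ (p + 1).
  rewrite ler_pdivrMr ?addr_gt0// ler_peMr ?powR_ge0// lerDr ltW//.
by apply: le_trans h1 _; rewrite lerDl divr_ge0// mulr_ge0 ?sqr_ge0// ltW.
Qed.

Lemma potential_ge0 w : `|w| <= a -> 0 <= potential p w.
Proof.
move=> /potential_ge; apply: le_trans; rewrite mulr_ge0 ?powR_ge0// subr_ge0.
by rewrite lef_pV2 ?posrE ?addr_gt0// lerD2r ltW.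
Qed.

Lemma force_gt0 w : 0 < w <= a -> 0 < force p w.
Proof.
move=> /andP[w0 wa].
have wa' : `|w| <= a by rewrite gtr0_norm.
rewrite -(pmulr_rgt0 _ w0); apply: lt_le_trans (mul_force_ge _ wa').
by rewrite mulr_gt0 ?subr_gt0// powR_gt0// normr_gt0 gt_eqF.
Qed.

Lemma potential_gt0 w : w != 0 -> `|w| <= a -> 0 < potential p w.
Proof.
move=> w0 wa; apply: lt_le_trans (potential_ge _ wa).
rewrite mulr_gt0 ?powR_gt0 ?normr_gt0// subr_gt0.
by rewrite ltf_pV2 ?posrE ?addr_gt0// ltrD2r.
Qed.

End below_equilibrium.

End nonlinearity.

(** * Energy and oscillation *)

Section profile_bound.
Context {R : realType}.
Variables (p a N : R) (W Y : R -> R).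
Hypotheses (p_gt0 : 0 < p) (p_lt1 : p < 1) (a_gt0 : 0 < a).
Hypothesis a_lt : (1 - p)^-1 * a `^ (1 - p) < 1.
Hypotheses (N_ge2 : 2 <= N) (W0 : W 0 = a) (Y0 : Y 0 = - force p a / N).
Hypotheses (Y_cont : continuous Y) (W_der : forall s : R, is_derive s 1 W (Y s)).
Hypothesis Y_der : forall s : R, 0 < s ->
  is_derive s 1 Y (- ((N + s) * Y s + cforce p a (W s)) / (4 * s)).

Definition energy s := 2 * s * Y s ^+ 2 + potential p (W s).

Lemma W_cont : continuous W.
Proof. by move=> s; exact: der_continuous (W_der s). Qed.

Lemma energy_continuous : continuous energy.
Proof.
move=> s; apply: cvgD.
  apply: cvgM; first by apply: cvgMl_tmp; exact: cvg_id.
  by rewrite expr2; apply: cvgM; exact: Y_cont.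
apply: (@continuous_comp _ _ _ W (potential p)); first exact: W_cont.
exact: der_continuous (der_potential p p_gt0 p_lt1 _).
Qed.

Lemma energy_der (s : R) : 0 < s -> `|W s| <= a ->
  is_derive s 1 energy (- (N - 2 + s) * Y s ^+ 2).
Proof.
move=> s0 Wa.
have H1 := der_mul _ _ _ _ _ (der_cmul 2 _ _ _ (der_id s)) (der_sqr _ _ _ (Y_der _ s0)).
have H2 := der_comp _ _ _ _ _ (der_potential p p_gt0 p_lt1 (W s)) (W_der s).
apply: derE (der_add _ _ _ _ _ H1 H2).
by rewrite cforceE//; field; rewrite gt_eqF.
Qed.

Lemma near_Y_lt0 : exists2 d : R, 0 < d & forall r : R, `|r| <= d -> Y r < 0.
Proof.
have Y0n : Y 0 < 0.
  by rewrite Y0 mulNr oppr_lt0 divr_gt0 ?(lt_le_trans _ N_ge2)// (force_gt0 _ _ _ a)// a_gt0 lexx.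
have : \forall r \near (0 : R), Y r < 0.
  exact: (cvgr_lt _ (Y_cont 0) _ Y0n).
by move=> /near_le_exists[d d0 H]; exists d => // r rd; apply: H; rewrite subr0.
Qed.

Lemma energy_lt (s : R) : 0 < s -> (forall r : R, 0 <= r <= s -> `|W r| <= a) ->
  energy s < potential p a.
Proof.
move=> s0 Ws; have [d d0 Yn] := near_Y_lt0.
pose u := Num.min d s.
have u0 : 0 < u by rewrite lt_min d0.
have us : u <= s by rewrite ge_min lexx orbT.
have ud : u <= d by rewrite ge_min lexx.
have E0 : energy 0 = potential p a by rewrite /energy W0 mulr0 mul0r add0r.
rewrite -E0; apply: (@le_lt_trans _ _ (energy u)).
  apply: (der_nincr_oo _ (fun s => - (N - 2 + s) * Y s ^+ 2)) => //.
  - move=> x /andP[ux xs]; have x0 := lt_trans u0 ux.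
    by apply: energy_der => //; apply: Ws; rewrite !ltW.
  - exact: energy_continuous.
  - move=> x /andP[ux xs]; have x0 := lt_trans u0 ux.
    rewrite mulNr oppr_le0 mulr_ge0 ?sqr_ge0// addr_ge0 ?subr_ge0// ltW//.
apply: (der_decr _ (fun s => - (N - 2 + s) * Y s ^+ 2)) => //.
- move=> x /andP[x0 xu]; apply: energy_der => //; apply: Ws.
  by rewrite ltW//= (le_trans (ltW xu)).
- exact: energy_continuous.
- move=> x /andP[x0 xu]; rewrite mulNr oppr_lt0 mulr_gt0//.
    by rewrite ltr_wpDl// subr_ge0.
  have : Y x < 0 by apply: Yn; rewrite gtr0_norm// (le_trans (ltW xu)).
  by move=> ?; rewrite exprn_even_gt0//= lt_eqF.
Qed.

Lemma profile_le (s : R) : 0 <= s -> `|W s| <= a.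
Proof.
move: s; apply: real_induction.
- by rewrite W0 gtr0_norm.
- move=> s; rewrite le_eqVlt => /predU1P[<- _|s0 Ws].
    have [d d0 Yn] := near_Y_lt0.
    have : \forall r \near (0 : R), - a < W r.
      have aW : - a < W 0 by rewrite W0 -subr_gt0 opprK addr_gt0.
      exact: (cvgr_gt _ (W_cont 0) _ aW).
    move=> /near_le_exists[e e0 H]; exists (Num.min d e); first by rewrite lt_min d0.
    move=> r /andP[r0]; rewrite add0r le_min => /andP[rd re].
    rewrite ler_norml (ltW (H _ _)) ?subr0 ?ger0_norm//= -W0.
    apply: (der_nincr_oo _ Y) => //; first exact: W_cont.
    move=> x /andP[x0 xr]; apply: ltW; apply: Yn.
    by rewrite gtr0_norm// (le_trans _ rd)// ltW.
  have Wsa : `|W s| < a.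
    rewrite lt_neqAle Ws ?lexx ?ltW// andbT; apply/eqP => E.
    have := energy_lt _ s0 Ws; rewrite -E potential_norm /energy.
    by rewrite gtrDr ltNge mulr_ge0 ?sqr_ge0// mulr_ge0// ltW.
  have : \forall r \near s, `|W r| < a.
    exact: (cvgr_lt _ (cvg_norm (W_cont s)) _ Wsa).
  move=> /near_le_exists[e e0 H]; exists e => // r /andP[sr rs].
  by apply/ltW/H; rewrite ger0_norm ?subr_ge0// lerBlDl.
- move=> s s0 Ws; rewrite leNgt; apply/negP => Wsa.
  have : \forall r \near s, a < `|W r|.
    exact: (cvgr_gt _ (cvg_norm (W_cont s)) _ Wsa).
  move=> /near_le_exists[e e0 H].
  pose u := Num.max 0 (s - e).
  have : `|W u| <= a.
    by apply: Ws; rewrite le_max lexx gt_max s0 gtrBl.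
  rewrite leNgt H// distrC ger0_norm; last first.
    by rewrite subr_ge0 ge_max ltW// gerBl ltW.
  by rewrite lerBlDl -lerBlDr le_max lexx orbT.
Qed.

Lemma profile_ode (s : R) : 0 < s ->
  is_derive s 1 Y (- ((N + s) * Y s + force p (W s)) / (4 * s)).
Proof.
by move=> s0; rewrite -(cforceE _ a) ?profile_le ?ltW//; exact: Y_der.
Qed.

Lemma potential_ge0_profile (s : R) : 0 <= s -> 0 <= potential p (W s).
Proof. by move=> s0; apply: (potential_ge0 _ _ _ a) => //; exact: profile_le. Qed.

Lemma energy_gt0 (s : R) : 0 < s -> 0 < energy s.
Proof.
move=> s0.
have E0 : 0 < energy 0.
  rewrite /energy W0 mulr0 mul0r add0r.
  by rewrite (potential_gt0 _ _ _ a)// ?gt_eqF// gtr0_norm.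
have : \forall r \near (0 : R), 0 < energy r.
  exact: (cvgr_gt _ (energy_continuous 0) _ E0).
move=> /near_le_exists[d d0 H].
pose u := Num.min d s.
have u0 : 0 < u by rewrite lt_min d0.
have us : u <= s by rewrite ge_min lexx orbT.
have Eu : 0 < energy u by apply: H; rewrite subr0 gtr0_norm// ge_min lexx.
pose rho (r : R) := expR ((N - 2) / 2 * ln r + 2^-1 * r).
have : energy u * rho u <= energy s * rho s.
  apply: (der_ndecr (fun r => energy r * rho r) (fun r => - (N - 2 + r) * Y r ^+ 2 * rho r
      + energy r * (rho r * ((N - 2) / 2 / r + 2^-1)))) => //.
    move=> x /andP[ux xs]; have x0 := lt_le_trans u0 ux.
    apply: der_mul; last exact: der_weight.
    by apply: energy_der => //; rewrite profile_le// ltW.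
  move=> x /andP[ux xs]; have x0 := lt_le_trans u0 ux.
  have r0 : 0 < rho x by exact: expR_gt0.
  have -> : - (N - 2 + x) * Y x ^+ 2 * rho x
      + energy x * (rho x * ((N - 2) / 2 / x + 2^-1)) =
    rho x * (N - 2 + x) / (2 * x) * potential p (W x).
    by rewrite /energy; field; rewrite gt_eqF.
  apply: mulr_ge0; last by apply: potential_ge0_profile; exact: ltW.
  rewrite divr_ge0 ?mulr_ge0 ?(ltW x0) ?(ltW r0)//.
  by rewrite addr_ge0 ?subr_ge0// ltW.
move=> /(lt_le_trans (mulr_gt0 Eu (expR_gt0 _))).
by rewrite pmulr_lgt0 ?expR_gt0.
Qed.

Lemma profile_zero_simple (s : R) : 0 < s -> W s = 0 -> Y s != 0.
Proof.
move=> s0 Ws; apply/eqP => Ys; have := energy_gt0 _ s0.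
have p1 : p + 1 != 0 by rewrite gt_eqF// addr_gt0.
rewrite /energy Ys Ws /potential normr0 powR0//.
by rewrite expr2 !(mulr0, mul0r) subrr addr0 ltxx.
Qed.

End profile_bound.

Section oscillation.
Context {R : realType}.
Variables (p a N : R) (V Z : R -> R) (S : R).
Hypotheses (p_gt0 : 0 < p) (p_lt1 : p < 1) (a_gt0 : 0 < a).
Hypothesis a_lt : (1 - p)^-1 * a `^ (1 - p) < 1.
Hypotheses (N_gt0 : 0 < N) (S_gt0 : 0 < S).
Hypothesis V_der : forall s : R, S <= s -> is_derive s 1 V (Z s).
Hypothesis Z_der : forall s : R, S <= s ->
  is_derive s 1 Z (- ((N + s) * Z s + force p (V s)) / (4 * s)).
Hypothesis V_itv : forall s : R, S <= s -> 0 < V s <= a.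

Let c : R := 1 - (1 - p)^-1 * a `^ (1 - p).

Let c_gt0 : 0 < c. Proof. by rewrite subr_gt0. Qed.

Let force_ge (v : R) : 0 < v <= a -> c * v `^ p <= force p v.
Proof.
move=> /andP[v0 va]; rewrite -(ler_pM2l v0).
have va' : `|v| <= a by rewrite gtr0_norm.
have := mul_force_ge p p_gt0 p_lt1 a v va'; apply: le_trans.
by rewrite mulrCA -(spow_ge0 _ p_gt0 _ (ltW v0)) mul_spow.
Qed.

Lemma tail_slope_lt0 : exists2 s : R, S <= s & Z s < 0.
Proof.
apply: contrapT => H.
have Z0 (s : R) : S <= s -> 0 <= Z s.
  by move=> Ss; rewrite leNgt; apply/negP => Zs; apply: H; exists s.
have V_ge (s : R) : S <= s -> V S <= V s.
  move=> Ss; apply: (der_ndecr _ Z) => // x /andP[Sx _]; [exact: V_der|exact: Z0].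
have /andP[VS0 VSa] := V_itv _ (lexx S).
pose g := c * V S `^ p.
have g0 : 0 < g by rewrite mulr_gt0// powR_gt0.
pose K := 4 * (Z S + 1) / g.
have K0 : 0 < K by rewrite divr_gt0// mulr_gt0// ltr_wpDl// Z0.
pose s := S * expR K.
have Ss : S <= s by rewrite ler_peMr ?(ltW S_gt0)// -expR0 ler_expR ltW.
have : Z s + g / 4 * ln s <= Z S + g / 4 * ln S.
  apply: (der_nincr (fun s => Z s + g / 4 * ln s)
    (fun x => - ((N + x) * Z x + force p (V x)) / (4 * x) + g / 4 * x^-1)) => //.
    move=> x /andP[Sx _]; have x0 := lt_le_trans S_gt0 Sx.
    apply: der_add; first exact: Z_der.
    by apply: der_cmul; exact: is_derive1_ln.
  move=> x /andP[Sx _]; have x0 := lt_le_trans S_gt0 Sx.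
  have -> : - ((N + x) * Z x + force p (V x)) / (4 * x) + g / 4 * x^-1 =
    (- ((N + x) * Z x) + (g - force p (V x))) / (4 * x).
    by field; rewrite gt_eqF.
  rewrite mulr_le0_ge0 ?invr_ge0 ?mulr_ge0 ?(ltW x0)//.
  rewrite -oppr_ge0 opprD opprK opprB addr_ge0//.
    by rewrite mulr_ge0 ?Z0// addr_ge0 ?ltW.
  rewrite subr_ge0; apply: le_trans (force_ge _ (V_itv _ Sx)).
  by rewrite ler_pM2l//; apply: le_powR; [exact: ltW|exact: ltW|exact: V_ge].
rewrite /s lnM ?posrE ?expR_gt0// expRK mulrDr.
have -> : g / 4 * K = Z S + 1 by rewrite /K; field; rewrite gt_eqF.
have := Z0 _ Ss; rewrite -/s; lra.
Qed.

Lemma tail_slope_le : exists2 s1 : R, S <= s1 & forall s : R, s1 <= s ->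
  Z s <= - (c * V s `^ p) / (N + s).
Proof.
have [s1 Ss1 Zs1] := tail_slope_lt0.
pose rho (r : R) := expR (N / 4 * ln r + 4^-1 * r).
have rho_gt0 r : 0 < rho r by exact: expR_gt0.
have key (s2 k : R) : s1 <= s2 -> (forall s, s1 <= s <= s2 -> k * (N + s) <= force p (V s)) ->
    rho s2 * (Z s2 + k) <= rho s1 * (Z s1 + k).
  move=> s12 Hk.
  apply: (der_nincr (fun s => rho s * (Z s + k))
    (fun x => rho x * (N / 4 / x + 4^-1) * (Z x + k) + rho x *
    (- ((N + x) * Z x + force p (V x)) / (4 * x) + 0)) _ _ s12).
    move=> x /andP[sx _]; have Sx := le_trans Ss1 sx.
    apply: der_mul; first by apply: der_weight; exact: lt_le_trans Sx.
    exact: (der_add _ _ _ _ _ (Z_der _ Sx) (der_cst _ _)).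
  move=> x /andP[sx xs2]; have Sx := le_trans Ss1 sx; have x0 := lt_le_trans S_gt0 Sx.
  have -> : rho x * (N / 4 / x + 4^-1) * (Z x + k) + rho x *
    (- ((N + x) * Z x + force p (V x)) / (4 * x) + 0) =
    rho x * (k * (N + x) - force p (V x)) / (4 * x) by field; rewrite gt_eqF.
  rewrite mulr_le0_ge0 ?invr_ge0 ?mulr_ge0 ?(ltW x0)// mulr_ge0_le0 ?(ltW (rho_gt0 _))//.
  by rewrite subr_le0 Hk// sx.
have Zn (s : R) : s1 <= s -> Z s < 0.
  move=> s1s; have := key s 0 s1s; rewrite !addr0 => H.
  have : rho s * Z s < 0.
    apply: le_lt_trans (H _) _; last by rewrite pmulr_rlt0.
    move=> r /andP[s1r _]; rewrite mul0r ltW// (force_gt0 _ _ _ a)//.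
    by apply: V_itv; exact: le_trans s1r.
  by rewrite pmulr_rlt0.
have V_le (s r : R) : s1 <= s -> s <= r -> V r <= V s.
  move=> s1s sr; apply: (der_nincr _ Z) => // x /andP[sx _]; have s1x := le_trans s1s sx.
    by apply: V_der; exact: le_trans s1x.
  by rewrite ltW// Zn.
pose s2 := Num.max s1 (c * a `^ p / - Z s1).
exists s2; first by rewrite le_max Ss1.
move=> s; rewrite ge_max => /andP[s1s sK].
have s0 : 0 < s by rewrite (lt_le_trans S_gt0)// (le_trans Ss1).
have Ns0 : 0 < N + s by rewrite addr_gt0.
have /andP[Vs0 Vsa] := V_itv _ (le_trans Ss1 s1s).
have H : rho s * (Z s + c * V s `^ p / (N + s)) <= rho s1 * (Z s1 + c * V s `^ p / (N + s)).
  apply: key => // r /andP[s1r rs].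
  have Sr := le_trans Ss1 s1r.
  have r0 := lt_le_trans S_gt0 Sr.
  have b0 : 0 <= c * V s `^ p by rewrite mulr_ge0 ?powR_ge0// ltW.
  apply: (@le_trans _ _ (c * V s `^ p)).
    by rewrite -mulrA ler_piMr// mulrC ler_pdivrMr// mul1r lerD2l.
  apply: le_trans (force_ge _ (V_itv _ Sr)); rewrite ler_pM2l//.
  by apply: le_powR; [exact: ltW|exact: ltW|exact: V_le].
have : rho s1 * (Z s1 + c * V s `^ p / (N + s)) <= 0.
  rewrite pmulr_rle0// -lerBrDl sub0r ler_pdivrMr//.
  have h1 : c * V s `^ p <= c * a `^ p.
    by rewrite ler_pM2l//; apply: le_powR; [exact: ltW|exact: ltW|].
  apply: le_trans h1 _.
  move: sK; rewrite ler_pdivrMr ?oppr_gt0// => h2.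
  have : 0 <= N * - Z s1 by rewrite mulr_ge0 ?oppr_ge0 ?(ltW N_gt0) ?(ltW Zs1).
  lra.
move=> /(le_trans H); rewrite pmulr_rle0// mulNr; lra.
Qed.

Lemma no_positive_tail : False.
Proof.
have [s1 Ss1 Zle] := tail_slope_le.
have cp0 : 0 < (1 - p) * c by rewrite mulr_gt0// subr_gt0.
have Ns0 (x : R) : s1 <= x -> 0 < N + x.
  by move=> sx; rewrite addr_gt0// (lt_le_trans S_gt0)// (le_trans Ss1).
have mono (s : R) : s1 <= s ->
    V s `^ (1 - p) + (1 - p) * c * ln (N + s) <= V s1 `^ (1 - p) + (1 - p) * c * ln (N + s1).
  move=> s1s; apply: (der_nincr (fun s => V s `^ (1 - p) + (1 - p) * c * ln (N + s))
    (fun x => (1 - p) * V x `^ (1 - p - 1) * Z x + (1 - p) * c * ((N + x)^-1 * (0 + 1))) _ _ s1s).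
    move=> x /andP[sx _]; have Sx := le_trans Ss1 sx.
    have /andP[Vx0 _] := V_itv _ Sx.
    apply: der_add.
      exact: (der_comp (fun v : R => v `^ (1 - p)) V _ _ _ (is_derive1_powR _ Vx0) (V_der _ Sx)).
    apply: der_cmul.
    apply: (der_comp (@ln R) (fun x => N + x)); first by apply: is_derive1_ln; exact: Ns0.
  move=> x /andP[sx _]; have Sx := le_trans Ss1 sx.
  have /andP[Vx0 _] := V_itv _ Sx.
  have -> : 1 - p - 1 = - p by ring.
  rewrite add0r mulr1 powRN.
  have Vp : 0 < V x `^ p by rewrite powR_gt0.
  have -> : (1 - p) * (V x `^ p)^-1 * Z x + (1 - p) * c * (N + x)^-1 =
    (1 - p) / V x `^ p * (Z x + c * V x `^ p / (N + x)).
    by field; rewrite !gt_eqF// Ns0.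
  rewrite mulr_ge0_le0//; first by rewrite divr_ge0 ?powR_ge0// subr_ge0 ltW.
  by have := Zle _ sx; rewrite mulNr; lra.
pose H := V s1 `^ (1 - p) + (1 - p) * c * ln (N + s1).
pose K := H / ((1 - p) * c) + 1.
pose s := Num.max s1 (expR K).
have s1s : s1 <= s by rewrite le_max lexx.
have := mono _ s1s; rewrite -/H.
have h1 : 0 <= V s `^ (1 - p) by exact: powR_ge0.
have h2 : K <= ln (N + s).
  rewrite -[K]expRK ler_ln ?posrE ?expR_gt0 ?Ns0//.
  by rewrite (@le_trans _ _ s)// ?lerDr ?(ltW N_gt0)// le_max lexx orbT.
have : (1 - p) * c * K <= (1 - p) * c * ln (N + s) by rewrite ler_pM2l.
have -> : (1 - p) * c * K = H + (1 - p) * c by rewrite /K; field; rewrite !gt_eqF// subr_gt0.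
lra.
Qed.

End oscillation.

(** * Decay *)

Lemma ln_large {R : realType} (K : R) : exists2 s1 : R, 0 < s1 & forall s : R, s1 <= s -> K <= ln s.
Proof.
exists (expR K); first exact: expR_gt0.
move=> s ss; rewrite -[K]expRK ler_ln ?posrE ?expR_gt0//.
by apply: lt_le_trans ss; exact: expR_gt0.
Qed.

Lemma expR_ln_small {R : realType} (C k e : R) : 0 < k -> 0 < e ->
  exists2 s1 : R, 0 < s1 & forall s : R, s1 <= s -> C * expR (- k * ln s) <= e.
Proof.
move=> k0 e0; have [s1 s10 H] := ln_large (ln ((`|C| + 1) / e) / k).
have C1 : 0 < (`|C| + 1) / e by rewrite divr_gt0// ltr_wpDl.
exists s1 => // s /H; rewrite ler_pdivrMr// => h.
have : expR (- k * ln s) <= e / (`|C| + 1).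
  rewrite mulNr expRN -[leRHS]invrK lef_pV2 ?posrE ?expR_gt0 ?invr_gt0 ?divr_gt0 ?ltr_wpDl//.
  by rewrite invf_div -[leLHS]lnK ?posrE// ler_expR [leRHS]mulrC.
rewrite ler_pdivlMr ?ltr_wpDl// => h1.
apply: le_trans h1; rewrite mulrC ler_wpM2l ?expR_ge0//.
by rewrite (le_trans (ler_norm C))// lerDl.
Qed.

Section decay.
Context {R : realType}.
Variables (p a N : R) (W Y : R -> R).
Hypotheses (p_gt0 : 0 < p) (p_lt1 : p < 1) (a_gt0 : 0 < a).
Hypothesis a_lt : (1 - p)^-1 * a `^ (1 - p) < 1.
Hypothesis N_ge2 : 2 <= N.
Hypothesis W_der : forall s : R, is_derive s 1 W (Y s).
Hypothesis Y_der : forall s : R, 0 < s ->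
  is_derive s 1 Y (- ((N + s) * Y s + force p (W s)) / (4 * s)).
Hypothesis W_le : forall s : R, 0 <= s -> `|W s| <= a.

Let c : R := 1 - (1 - p)^-1 * a `^ (1 - p).

Let c' : R := (p + 1)^-1 - 2^-1.

Let c_gt0 : 0 < c. Proof. by rewrite subr_gt0. Qed.

Let c'_gt0 : 0 < c'.
Proof. by rewrite subr_gt0 ltf_pV2 ?posrE ?addr_gt0// ltrD2r. Qed.

Let q (s : R) := `|W s| `^ (p + 1).

Let q_ge0 s : 0 <= q s. Proof. exact: powR_ge0. Qed.

(* The cross term turns the damping of [Y] into damping of the full energy. *)
Let J (d s : R) := 2 * s * Y s ^+ 2 + potential p (W s) + d * (W s * Y s).

Let J_der (d s : R) : 0 < s -> is_derive s 1 (J d)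
  (- (N - 2 + s - d) * Y s ^+ 2 - d * (N + s) / (4 * s) * (W s * Y s)
   - d * (W s * force p (W s)) / (4 * s)).
Proof.
move=> s0.
have H1 := der_mul _ _ _ _ _ (der_cmul 2 _ _ _ (der_id s)) (der_sqr _ _ _ (Y_der _ s0)).
have H2 := der_comp _ _ _ _ _ (der_potential p p_gt0 p_lt1 (W s)) (W_der s).
have H3 := der_cmul d _ _ _ (der_mul _ _ _ _ _ (W_der s) (Y_der _ s0)).
apply: derE (der_add _ _ _ _ _ (der_add _ _ _ _ _ H1 H2) H3).
by field; rewrite gt_eqF.
Qed.

Let sqr_le (d s : R) : d * `|W s| `^ (1 - p) <= c / 2 ->
  d * W s ^+ 2 <= c / 2 * q s.
Proof. by move=> H; rewrite (sqr_powR p) mulrA ler_wpM2r. Qed.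

Lemma decay_rate (d s1 : R) : 0 < d -> 2 * d <= s1 -> N <= s1 -> d * c <= s1 ->
  d * c / (4 * c') <= s1 ->
  (forall s : R, s1 <= s -> d * `|W s| `^ (1 - p) <= c / 2) ->
  exists C : R, forall s : R, s1 <= s ->
    q s <= C * expR (- (d * c / 12) * ln s).
Proof.
move=> d0 s1d s1N s1c s1c' Hd.
pose k := d * c / 12.
have s10 : 0 < s1 by rewrite (lt_le_trans _ s1d)// mulr_gt0.
have Wf (s : R) : s1 <= s -> c * q s <= W s * force p (W s).
  by move=> ss; apply: mul_force_ge => //; apply: W_le; rewrite (le_trans _ ss)// ltW.
have Fge (s : R) : s1 <= s -> c' * q s <= potential p (W s).
  by move=> ss; apply: (potential_ge _ _ a) => //; apply: W_le; rewrite (le_trans _ ss)// ltW.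
have Fle (s : R) : potential p (W s) <= q s by exact: potential_le.
have cross (s : R) : s1 <= s -> `|d * (W s * Y s)| <= s * Y s ^+ 2 + potential p (W s) / 2.
  move=> ss; have s0 := lt_le_trans s10 ss.
  have h1 := sqr_le _ _ (Hd _ ss).
  have h2 : d * (d * W s ^+ 2) / (4 * s) <= potential p (W s) / 2.
    rewrite ler_pdivrMr ?mulr_gt0//.
    have := ler_wpM2l (ltW d0) h1; have := Fge _ ss.
    move: s1c'; rewrite ler_pdivrMr ?mulr_gt0// => s1c' h3 h4.
    apply: le_trans h4 _.
    have h5 := ler_wpM2r (q_ge0 s) s1c'.
    have h6 : 2 * s1 * (c' * q s) <= 2 * s * potential p (W s).
      apply: ler_pM => //; rewrite ?mulr_ge0 ?(ltW s10) ?(ltW c'_gt0)//.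
      by rewrite ler_pM2l.
    lra.
  have h3 (e : R) : e ^+ 2 = 1 ->
      e * (d * (W s * Y s)) <= s * Y s ^+ 2 + d * (d * W s ^+ 2) / (4 * s).
    move=> e1; rewrite -subr_ge0.
    have -> : s * Y s ^+ 2 + d * (d * W s ^+ 2) / (4 * s) - e * (d * (W s * Y s)) =
      (2 * s * Y s - e * d * W s) ^+ 2 / (4 * s) + (1 - e ^+ 2) * (d * (d * W s ^+ 2) / (4 * s)).
      by field; rewrite gt_eqF.
    by rewrite e1 subrr mul0r addr0 divr_ge0 ?sqr_ge0// mulr_ge0// ltW.
  have hp := h3 1 (expr1n _ _); have hn := h3 (-1) (etrans (sqrrN 1) (expr1n _ _)).
  by rewrite ler_norml; apply/andP; split; lra.
have Jge (s : R) : s1 <= s -> c' * q s <= 2 * J d s.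
  move=> ss; have s0 := lt_le_trans s10 ss.
  have := cross _ ss; rewrite ler_norml => /andP[h1 _].
  have := Fge _ ss; have : 0 <= s * Y s ^+ 2 by rewrite mulr_ge0 ?sqr_ge0// ltW.
  rewrite /J; lra.
have Jle (s : R) : s1 <= s -> J d s <= 3 * (s * Y s ^+ 2) + 3 / 2 * q s.
  move=> ss; have := cross _ ss; rewrite ler_norml => /andP[_ h1].
  have := Fle s; rewrite /J; lra.
have k0 : 0 < k by rewrite !mulr_gt0.
pose rho (s : R) := expR (k * ln s + 0 * s).
have mono (s : R) : s1 <= s -> J d s * rho s <= J d s1 * rho s1.
  move=> ss; apply: (der_nincr (fun s => J d s * rho s)
    (fun s => (- (N - 2 + s - d) * Y s ^+ 2 - d * (N + s) / (4 * s) * (W s * Y s)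
   - d * (W s * force p (W s)) / (4 * s)) * rho s + J d s * (rho s * (k / s + 0))) _ _ ss).
    move=> x /andP[sx _]; have x0 := lt_le_trans s10 sx.
    exact: der_mul (J_der d _ x0) (der_weight _ _ _ x0).
  move=> x /andP[sx _]; have x0 := lt_le_trans s10 sx.
  have -> : (- (N - 2 + x - d) * Y x ^+ 2 - d * (N + x) / (4 * x) * (W x * Y x)
   - d * (W x * force p (W x)) / (4 * x)) * rho x + J d x * (rho x * (k / x + 0)) =
   rho x / x * (- x * (N - 2 + x - d) * Y x ^+ 2 - d * (N + x) / 4 * (W x * Y x)
     - d * (W x * force p (W x)) / 4 + k * J d x).
    by field; rewrite gt_eqF.
  apply: mulr_ge0_le0; first by rewrite divr_ge0 ?expR_ge0 ?ltW.
  have y2 : 0 <= x * Y x ^+ 2 by rewrite mulr_ge0 ?sqr_ge0 ?ltW.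
  have t1 : - x * (N - 2 + x - d) * Y x ^+ 2 <= - (x / 2) * (x * Y x ^+ 2).
    have -> : - x * (N - 2 + x - d) * Y x ^+ 2 = - (N - 2 + x - d) * (x * Y x ^+ 2) by ring.
    by rewrite ler_wpM2r// lerN2; have := le_trans s1d sx; have := N_ge2; lra.
  have t2 : - (d * (N + x) / 4 * (W x * Y x)) <= x / 4 * (x * Y x ^+ 2) + d * (d * W x ^+ 2) / 4.
    have e1 : - (d * (N + x) / 4 * (W x * Y x)) <= (N + x) / 4 * `|d * (W x * Y x)|.
      have -> : - (d * (N + x) / 4 * (W x * Y x)) = (N + x) / 4 * - (d * (W x * Y x)) by ring.
      rewrite ler_wpM2l//; first by rewrite divr_ge0// addr_ge0 ?(ltW x0)//; have := N_ge2; lra.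
      by rewrite -normrN ler_norm.
    apply: le_trans e1 _.
    apply: (@le_trans _ _ (x / 2 * `|d * (W x * Y x)|)).
      by rewrite ler_wpM2r//; lra.
    have h3 (e : R) : e ^+ 2 = 1 -> x / 2 * (e * (d * (W x * Y x))) <=
        x / 4 * (x * Y x ^+ 2) + d * (d * W x ^+ 2) / 4.
      move=> ee; rewrite -subr_ge0.
      have -> : x / 4 * (x * Y x ^+ 2) + d * (d * W x ^+ 2) / 4 - x / 2 * (e * (d * (W x * Y x))) =
        (x * Y x - e * d * W x) ^+ 2 / 4 + (1 - e ^+ 2) * (d * (d * W x ^+ 2) / 4) by field.
      by rewrite ee subrr mul0r addr0 divr_ge0 ?sqr_ge0.
    have hp := h3 1 (expr1n _ _); have hn := h3 (-1) (etrans (sqrrN 1) (expr1n _ _)).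
    by case: (ger0P (d * (W x * Y x))) => h; lra.
  have t3 : d * (c * q x) / 4 <= d * (W x * force p (W x)) / 4.
    by rewrite ler_pM2r ?invr_gt0// ler_pM2l// Wf.
  have t4 : d * (d * W x ^+ 2) <= d * (c / 2 * q x).
    by rewrite ler_pM2l// sqr_le// Hd.
  have t5 : k * J d x <= k * (3 * (x * Y x ^+ 2) + 3 / 2 * q x).
    by rewrite ler_pM2l// Jle.
  have t6 : 3 * k * (x * Y x ^+ 2) <= x / 4 * (x * Y x ^+ 2).
    by rewrite ler_wpM2r// /k; have := le_trans s1c sx; lra.
  rewrite /k in t5 t6 *; lra.
exists (2 / c' * (J d s1 * rho s1)) => s ss; have s0 := lt_le_trans s10 ss.
have r0 : 0 < rho s by exact: expR_gt0.
have -> : expR (- (d * c / 12) * ln s) = (rho s)^-1.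
  by rewrite -expRN /rho mul0r addr0 mulNr.
rewrite ler_pdivlMr// mulrAC ler_pdivlMr// mulrC mulrA.
have := ler_wpM2r (ltW r0) (Jge _ ss); have := mono _ ss; lra.
Qed.

Lemma superpolynomial_decay (k : R) : 0 < k -> exists C s1 : R, 0 < s1 /\
  forall s : R, s1 <= s -> q s <= C * expR (- k * ln s).
Proof.
have main (d s0 : R) : 0 < d -> (forall s : R, s0 <= s -> d * `|W s| `^ (1 - p) <= c / 2) ->
    exists C s1 : R, 0 < s1 /\
      forall s : R, s1 <= s -> q s <= C * expR (- (d * c / 12) * ln s).
  move=> d0 Hd.
  pose s1 := Num.max s0 (Num.max (2 * d) (Num.max N (Num.max (d * c) (d * c / (4 * c'))))).
  have [|||||C HC] := decay_rate d s1 d0.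
  - by rewrite !le_max lexx !orbT.
  - by rewrite !le_max lexx !orbT.
  - by rewrite !le_max lexx !orbT.
  - by rewrite !le_max lexx !orbT.
  - by move=> s; rewrite ge_max => /andP[/Hd].
  exists C, s1; split => //.
  by rewrite lt_max lt_max mulr_gt0// orbT.
move=> k0.
pose d1 := c / 2 / (a `^ (1 - p)).
have ap : 0 < a `^ (1 - p) by exact: powR_gt0.
have d10 : 0 < d1 by rewrite !divr_gt0.
have [s Ws|C1 [s1 [s10 H1]]] := main d1 0 d10.
  rewrite /d1 mulrAC ler_pdivrMr// ler_pM2l ?divr_gt0//.
  by apply: le_powR; rewrite ?subr_ge0 ?(ltW p_lt1)// W_le.
pose d2 := 12 * k / c.
have d20 : 0 < d2 by rewrite !divr_gt0// mulr_gt0.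
have k1 : 0 < d1 * c / 12 by rewrite divr_gt0// mulr_gt0.
have r0 : 0 < (1 - p) / (p + 1) by rewrite divr_gt0 ?subr_gt0 ?addr_gt0.
have c20 : 0 < c / 2 by rewrite divr_gt0.
have e0 : 0 < c / 2 / d2 by rewrite divr_gt0.
have [e ep He] := near0_powR _ r0 _ e0.
have [s2 s20 H2] := expR_ln_small C1 _ _ k1 ep.
have -> : k = d2 * c / 12 by rewrite /d2; field; rewrite gt_eqF.
apply: (main d2 (Num.max s1 s2)) => // s; rewrite ge_max => /andP[ss1 ss2].
rewrite mulrC -ler_pdivlMr//.
have -> : `|W s| `^ (1 - p) = `|q s| `^ ((1 - p) / (p + 1)).
  rewrite (ger0_norm (q_ge0 s)) /q -powRrM; congr (_ `^ _); field.
  by rewrite gt_eqF// addr_gt0.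
apply: He; rewrite ger0_norm//; apply: le_trans (H1 _ ss1) _; exact: H2.
Qed.

Lemma profile_powR_bound (r : R) (n : nat) : 0 < r ->
  exists2 C : R, 0 < C & forall s : R, 0 <= s -> `|W s| `^ r * (1 + s) ^+ n <= C.
Proof.
move=> r0.
have p1 : 0 < p + 1 by rewrite addr_gt0.
pose k := (n.+1)%:R * (p + 1) / r.
have k0 : 0 < k by rewrite divr_gt0// mulr_gt0.
have [C1 [s1 [s10 H1]]] := superpolynomial_decay _ k0.
pose C2 := `|C1| `^ (r / (p + 1)) * 2 ^+ n.
pose S := Num.max s1 1.
pose C3 := a `^ r * (1 + S) ^+ n.
have S1 : 1 <= S by rewrite le_max lexx orbT.
have S0 : 0 <= S by exact: le_trans S1.
have C20 : 0 <= C2 by rewrite mulr_ge0 ?powR_ge0// exprn_ge0.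
have C30 : 0 < C3 by rewrite mulr_gt0 ?powR_gt0// exprn_gt0// ltr_wpDr.
exists (C2 + C3); first by rewrite ltr_wpDl.
move=> s s0; have [sS|sS] := leP s S.
  apply: (@le_trans _ _ C3); last by rewrite lerDr.
  apply: ler_pM; rewrite ?powR_ge0 ?exprn_ge0 ?addr_ge0//.
    by apply: le_powR; rewrite ?(ltW r0)// W_le.
  by rewrite lerXn2r ?nnegrE ?addr_ge0// lerD2l.
apply: (@le_trans _ _ C2); last by rewrite lerDl ltW.
have s1s : s1 <= s by rewrite (le_trans _ (ltW sS))// le_max lexx.
have s1' : 1 <= s by rewrite (le_trans S1)// ltW.
have sp : 0 < s by rewrite (lt_le_trans _ s1').
have -> : `|W s| `^ r = q s `^ (r / (p + 1)).
  rewrite /q -powRrM; congr (_ `^ _); field.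
  by rewrite gt_eqF.
have h1 : q s `^ (r / (p + 1)) <= `|C1| `^ (r / (p + 1)) * (s ^+ n)^-1.
  apply: (@le_trans _ _ ((`|C1| * expR (- k * ln s)) `^ (r / (p + 1)))).
    apply: le_powR => //; first by rewrite divr_ge0 ?ltW.
    apply: le_trans (H1 _ s1s) _; rewrite ler_wpM2r ?expR_ge0//; exact: ler_norm.
  rewrite powRM ?expR_ge0// ler_wpM2l ?powR_ge0//.
  rewrite /powR gt_eqF ?expR_gt0// expRK -exprVn -[X in _ <= X ^+ _]lnK ?posrE ?invr_gt0//.
  rewrite -expRM_natl lnV ?posrE// ler_expR.
  have -> : r / (p + 1) * (- k * ln s) = - (n.+1%:R * ln s).
    by rewrite /k; field; rewrite !gt_eqF.
  rewrite mulrN lerN2 ler_wpM2r ?ln_ge0// ler_nat//.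
apply: (@le_trans _ _ (`|C1| `^ (r / (p + 1)) * (s ^+ n)^-1 * (2 * s) ^+ n)).
  apply: ler_pM; rewrite ?powR_ge0 ?exprn_ge0 ?addr_ge0//.
  rewrite lerXn2r ?nnegrE ?addr_ge0 ?mulr_ge0//; lra.
rewrite exprMn /C2 -mulrA ler_wpM2l ?powR_ge0// mulrCA mulVf ?mulr1//.
by rewrite expf_neq0// gt_eqF.
Qed.

End decay.

(* [W] is the profile in the variable [s = eta ^ 2] and [Y] is its derivative; the first
   condition of the second group is the equation at the singular point [s = 0]. *)
Definition profile {R : realType} (n : nat) (p a : R) (W Y : R -> R) : Prop :=
  [/\ W 0 = a, continuous Y, forall s : R, is_derive s 1 W (Y s)
    & forall s : R, 0 < s ->
        is_derive s 1 Y (- ((2 * n%:R + s) * Y s + force p (W s)) / (4 * s))]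
  /\ [/\ 2 * n%:R * Y 0 + force p a = 0,
      forall s : R, 0 <= s -> `|W s| <= a,
      forall s : R, 0 < s -> W s = 0 -> Y s != 0,
      forall S : R, 0 < S -> exists2 s : R, S <= s & W s = 0
    & forall r : R, 0 < r -> exists2 C : R, 0 < C &
        forall s : R, 0 <= s -> `|W s| `^ r * (1 + s) ^+ n <= C].

Lemma unbounded_zeros {R : realType} (p a N : R) (W Y : R -> R) :
  0 < p -> p < 1 -> 0 < a -> (1 - p)^-1 * a `^ (1 - p) < 1 -> 0 < N ->
  (forall s : R, is_derive s 1 W (Y s)) ->
  (forall s : R, 0 < s ->
     is_derive s 1 Y (- ((N + s) * Y s + force p (W s)) / (4 * s))) ->
  (forall s : R, 0 <= s -> `|W s| <= a) ->
  forall S : R, 0 < S -> exists2 s : R, S <= s & W s = 0.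
Proof.
move=> p0 p1 a0 am N0 Wd Yd Wa S S0; apply: contrapT => H.
have Wn (s : R) : S <= s -> W s != 0 by move=> Ss; apply/eqP => E; apply: H; exists s.
have Wc : continuous W by move=> s; exact: der_continuous (Wd s).
have sg (s : R) : S <= s -> 0 < W S * W s.
  move=> Ss; rewrite ltNge; apply/negP => h.
  have [||c] := @IVT R W S s 0 Ss.
  - exact: continuous_subspaceT.
  - have [h1|h1] := ltP (W S) 0.
      have h2 : 0 <= W s by move: h; rewrite nmulr_rle0.
      by rewrite ge_min le_max (ltW h1) h2 orbT.
    have h1' : 0 < W S by rewrite lt_neqAle h1 eq_sym Wn.
    have h2 : W s <= 0 by move: h; rewrite pmulr_rle0.
    by rewrite ge_min le_max h2 h1 orbT.
  - by rewrite in_itv /= => /andP[Sc _] /eqP; apply/negP/Wn.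
have [h|h] := ltP (W S) 0; last first.
  have h' : 0 < W S by rewrite lt_neqAle h eq_sym Wn.
  apply: (no_positive_tail p a N W Y S) => //.
    by move=> s Ss; apply: Yd; exact: lt_le_trans Ss.
  move=> s Ss; have := sg _ Ss; rewrite pmulr_rgt0// => Ws; rewrite Ws/=.
  by rewrite (le_trans (ler_norm _))// Wa// (le_trans (ltW S0)).
apply: (no_positive_tail p a N (fun s => - W s) (fun s => - Y s) S) => //.
- move=> s Ss; have s0 := lt_le_trans S0 Ss.
  have := is_deriveN (Yd _ s0); apply: derE.
  by rewrite forceN; ring.
- move=> s Ss; have := sg _ Ss; rewrite nmulr_rgt0// oppr_gt0 => Ws; rewrite Ws/=.
  by rewrite (le_trans (ler_norm _))// normrN Wa// (le_trans (ltW S0)).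
Qed.

Lemma profile_exists {R : realType} (n : nat) (p a : R) : (0 < n)%N ->
  0 < p < 1 -> 0 < a < (1 - p) `^ (1 - p)^-1 ->
  exists W Y : R -> R, profile n p a W Y.
Proof.
move=> n0 /andP[p0 p1] /andP[a0 alt].
have q0 : 0 < 1 - p by rewrite subr_gt0.
have am : (1 - p)^-1 * a `^ (1 - p) < 1.
  rewrite ltr_pdivrMl// mulr1.
  have := @gt0_ltr_powR R _ q0 a ((1 - p) `^ (1 - p)^-1).
  rewrite !nnegrE (ltW a0) powR_ge0 => /(_ isT isT alt).
  by rewrite -powRrM mulVf ?gt_eqF// powRr1 ?(ltW q0).
have N2 : 2 <= 2 * n%:R :> R by rewrite ler_peMr// ler1n.
have N0 : 0 < 2 * n%:R :> R by rewrite (lt_le_trans _ N2).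
have L0 : 0 <= 2 * a `^ (p - 1) + (1 - p)^-1.
  by rewrite addr_ge0 ?mulr_ge0 ?powR_ge0// invr_ge0 ltW.
have [W [Y [W0 Y0 Yc Wd Yd]]] := radial_ode_exists (cforce p a) a _ _ _ N0 L0
  (cforce_continuous p p0 a) (cforce_bounded p p0 p1 a a0) (cforce_lip p p0 p1 a a0).
have Y0' : Y 0 = - force p a / (2 * n%:R).
  by rewrite Y0 cforceE// gtr0_norm.
have Wa := profile_le p a _ W Y p0 p1 a0 am N2 W0 Y0' Yc Wd Yd.
have Yd' := profile_ode p a _ W Y p0 p1 a0 am N2 W0 Y0' Yc Wd Yd.
exists W, Y; split; split => //.
- by rewrite Y0' mulrC divfK ?gt_eqF// addrC subrr.
- exact: (profile_zero_simple p a _ W Y p0 p1 a0 am N2 W0 Y0' Yc Wd Yd).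
- exact: (unbounded_zeros p a _ W Y p0 p1 a0 am N0 Wd Yd' Wa).
- move=> r r0.
  exact: (profile_powR_bound p a _ W Y p0 p1 a0 am N2 Wd Yd' Wa r n r0).
Qed.

Lemma seq_bounded {R : realDomainType} (s : seq R) :
  exists M : R, forall x : R, x \in s -> x <= M.
Proof.
elim: s => [|y s [M HM]]; first by exists 0.
exists (Num.max y M) => x; rewrite inE => /predU1P[->|/HM xM].
  by rewrite le_max lexx.
by rewrite le_max xM orbT.
Qed.

Lemma simple_zero_isolated {R : realType} (f : R -> R) (x d : R) :
  is_derive x 1 f d -> f x = 0 -> d != 0 ->
  exists2 e : R, 0 < e & forall y : R, `|y - x| <= e -> f y = 0 -> y = x.
Proof.
move=> [cv Ed] fx d0.
have cvd : h^-1 *: (f (h *: (1 : R) + x) - f x) @[h --> 0^'] --> d.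
  by rewrite -Ed; exact: cv.
have nd : 0 < `|d| by rewrite normr_gt0.
move/cvgrPdist_lt : cvd => /(_ _ nd) H.
have : \forall h \near (0 : R), h != 0 -> f (h + x) != 0.
  move: H; rewrite /dnbhs near_withinE; apply: filterS => h H h0.
  by apply/eqP => wh; move: (H h0); rewrite scaler1 wh fx subrr scaler0 subr0 ltxx.
move=> /near_le_exists[e e0 He]; exists e => // y yx fy.
apply/eqP; apply: contraT => nyx.
have := He (y - x); rewrite subr0 subrK subr_eq0 nyx => /(_ yx isT).
by rewrite fy eqxx.
Qed.

Section oscillation_of_profile.
Context {R : realType}.
Variables (n : nat) (p a : R) (W Y : R -> R).
Hypotheses (a_gt0 : 0 < a) (WY : profile n p a W Y).

Let W_der (s : R) : is_derive s 1 W (Y s).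
Proof. by case: WY => -[_ _ H _] _; exact: H. Qed.

Let w (eta : R) := W (eta ^+ 2).

Let w_der (x : R) : is_derive x 1 w (Y (x ^+ 2) * (2 * x * 1)).
Proof. exact: (der_comp W (fun x => x ^+ 2) _ _ _ (W_der _) (der_sqr _ _ _ (der_id x))). Qed.

Lemma zeros_isolated : zeros w `<=` isolated (zeros w).
Proof.
move=> x [x0 wx]; split; first by rewrite inE.
have xp : 0 < x.
  rewrite lt_neqAle x0 andbT eq_sym; apply/eqP => E; move: wx.
  rewrite E /w expr0n /=; case: WY => -[-> _ _ _] _ /eqP.
  by rewrite gt_eqF.
have x2 : 0 < x ^+ 2 by rewrite exprn_gt0.
have Yx : Y (x ^+ 2) * (2 * x * 1) != 0.
  have Y0 : Y (x ^+ 2) != 0 by case: WY => _ [_ _ H _ _]; exact: H.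
  by rewrite mulr1 mulf_neq0// mulf_neq0// gt_eqF.
have [d d0 Hd] := simple_zero_isolated _ _ _ (w_der x) wx Yx.
exists [set y | `|y - x| < d].
  by apply/nbhs_ballP; exists d => //= y; rewrite /ball /= distrC.
apply/seteqP; split => [y [/= yd [y0 wy]]|y /= ->]; first exact: Hd (ltW yd) wy.
by rewrite subrr normr0.
Qed.

Lemma zeros_unbounded (eta0 : R) : exists2 eta : R, eta0 <= eta & zeros w eta.
Proof.
case: WY => _ [_ _ _ H _].
have S0 : 0 < `|eta0| ^+ 2 + 1 by rewrite ltr_wpDl// exprn_ge0.
have [s Ss Ws] := H _ S0.
have s0 : 0 <= s by rewrite (le_trans (ltW S0)).
exists (Num.sqrt s); last by split; [exact: sqrtr_ge0|rewrite /w sqr_sqrtr].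
apply: le_trans (ler_norm _) _.
rewrite -(sqrtr_sqr eta0) ler_sqrt// -real_normK ?num_real//.
by apply: le_trans Ss; rewrite lerDl.
Qed.

Lemma profile_oscillates : oscillates w.
Proof.
split; first exact: zeros_isolated.
move=> eta0 _ /finite_seqP[s Es].
have [M HM] := seq_bounded s.
have [eta Heta wz] := zeros_unbounded (Num.max eta0 (M + 1)).
have : [set` s] eta.
  rewrite -Es; split; first exact: zeros_isolated.
  by apply: le_trans Heta; rewrite /= le_max lexx.
move=> /HM; apply/negP; rewrite -ltNge.
by apply: lt_le_trans Heta; rewrite lt_max ltrDl ltr01 orbT.
Qed.

End oscillation_of_profile.

(** * The self-similar solution *)

Section sqnorm.
Context {R : realType} {n : nat}.
Implicit Types (x : 'rV[R]_n) (i j : 'I_n).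

Definition sqnorm x : R := \sum_i x 0 i ^+ 2.

Lemma sqnorm_ge0 x : 0 <= sqnorm x.
Proof. by apply: sumr_ge0 => i _; exact: sqr_ge0. Qed.

Lemma sqr_coord_le x i : x 0 i ^+ 2 <= sqnorm x.
Proof.
rewrite /sqnorm (bigD1 i)//= lerDl; apply: sumr_ge0 => j _; exact: sqr_ge0.
Qed.

Lemma sqnorm_eq0 x i : sqnorm x = 0 -> x 0 i = 0.
Proof.
move=> x0; apply/eqP; rewrite -sqrf_eq0 eq_le sqr_ge0 andbT -x0.
exact: sqr_coord_le.
Qed.

Lemma norm_coord_mul_le x i j : `|x 0 i * x 0 j| <= sqnorm x.
Proof.
have h1 := sqr_coord_le x i; have h2 := sqr_coord_le x j.
have h3 := sqr_ge0 (x 0 i - x 0 j); have h4 := sqr_ge0 (x 0 i + x 0 j).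
by rewrite ler_norml; apply/andP; split; lra.
Qed.

Lemma coord_shift x i j (h : R) :
  (h *: delta_mx 0 i + x) 0 j = x 0 j + h * (i == j)%:R.
Proof. by rewrite !mxE eqxx /= eq_sym addrC. Qed.

Lemma sqnorm_shift x i (h : R) :
  sqnorm (h *: delta_mx 0 i + x) = sqnorm x + 2 * x 0 i * h + h ^+ 2.
Proof.
rewrite /sqnorm (bigD1 i)//= [X in _ = X + _ + _](bigD1 i)//= coord_shift eqxx.
under eq_bigr => j ji do rewrite coord_shift [i == j]eq_sym (negbTE ji) mulr0 addr0.
by rewrite mulr1; ring.
Qed.

Lemma sqnorm_continuous x : {for x, continuous sqnorm}.
Proof.
have main (r : seq 'I_n) (y : 'rV[R]_n) :
    {for y, continuous (fun x : 'rV[R]_n => \sum_(i <- r) x 0 i ^+ 2)}.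
  elim: r => [|i r IH].
    have -> : (fun x : 'rV[R]_n => \sum_(i <- [::]) x 0 i ^+ 2) = (fun=> 0).
      by apply/funext => z; rewrite big_nil.
    exact: cst_continuous.
  have -> : (fun x : 'rV[R]_n => \sum_(i <- i :: r) x 0 i ^+ 2) =
      (fun x : 'rV[R]_n => x 0 i * x 0 i + \sum_(i <- r) x 0 i ^+ 2).
    by apply/funext => z; rewrite big_cons expr2.
  have h : {for y, continuous (fun x : 'rV[R]_n => x 0 i * x 0 i)}.
    exact: (cvgM (@coord_continuous R 1 n 0 i y) (@coord_continuous R 1 n 0 i y)).
  exact: cvgD h IH.
exact: main.
Qed.

Lemma is_derive_dir (f : 'rV[R]_n -> R) x (v : 'rV[R]_n) (d : R) :
  is_derive (0 : R) 1 (fun h : R => f (h *: v + x)) d -> is_derive x v f d.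
Proof.
move=> [fd Ed]; split; first exact/derivable1P.
rewrite -Ed /derive; set g1 := fun h => h^-1 *: _; set g2 := fun h => h^-1 *: _.
suff -> : g1 = g2 by [].
by rewrite funeqE /g1 /g2 => h /=; rewrite addr0 scale0r add0r [_%:A]mulr1.
Qed.

End sqnorm.

Section self_similar.
Context {R : realType}.
Variables (n : nat) (p a : R) (W Y : R -> R).
Hypotheses (p_gt0 : 0 < p) (p_lt1 : p < 1) (WY : profile n p a W Y).

Let m : R := (1 - p)^-1.

Let N : R := 2 * n%:R.

Definition ssol (x : 'rV[R]_n) (t : R) : R := t `^ m * W (sqnorm x / t).

Let Q (s : R) : R := - ((N + s) * Y s + force p (W s)) / 4.

Let Y_cont : continuous Y. Proof. by case: WY => -[]. Qed.

Let W_der (s : R) : is_derive s 1 W (Y s). Proof. by case: WY => -[_ _ H _] _; exact: H. Qed.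

Let W_cont : continuous W. Proof. by move=> s; exact: der_continuous (W_der s). Qed.

Let Y_der (s : R) : 0 < s -> is_derive s 1 Y (Q s / s).
Proof.
move=> s0; case: WY => -[_ _ _ H] _; apply: derE (H _ s0).
by rewrite /Q -/N; field; rewrite gt_eqF.
Qed.

Let Q_cont : continuous Q.
Proof.
move=> s; apply: cvgMr_tmp; apply: cvgN; apply: cvgD.
  by apply: cvgM; [apply: cvgD; [exact: cvg_cst|exact: cvg_id]|exact: Y_cont].
apply: (@continuous_comp _ _ _ W (force p)); first exact: W_cont.
exact: force_continuous.
Qed.

Let Q0 : Q 0 = 0.
Proof.
rewrite /Q addr0 mulrC; case: WY => -[W0 _ _ _] [H _ _ _ _].
by rewrite W0 H oppr0 mulr0.
Qed.

Definition ssol_x (i : 'I_n) (x : 'rV[R]_n) (t : R) : R :=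
  2 * t `^ m / t * (x 0 i * Y (sqnorm x / t)).

(* At [x = 0] the quotient is [0 / 0 = 0], which is the right value since
   [s * Y' s] tends to [0] as [s] does. *)
Definition ssol_xx (i j : 'I_n) (x : 'rV[R]_n) (t : R) : R :=
  2 * t `^ m / t * ((j == i)%:R * Y (sqnorm x / t)
     + 2 * (x 0 i * x 0 j / sqnorm x) * Q (sqnorm x / t)).

Definition ssol_t (x : 'rV[R]_n) (t : R) : R :=
  t `^ m / t * (m * W (sqnorm x / t) - sqnorm x / t * Y (sqnorm x / t)).

Let arg_der (x : 'rV[R]_n) (i : 'I_n) (t : R) : is_derive (0 : R) 1
  (fun h : R => sqnorm (h *: delta_mx 0 i + x) / t) (2 * x 0 i / t).
Proof.
have -> : (fun h : R => sqnorm (h *: delta_mx 0 i + x) / t) =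
    (fun h : R => t^-1 * (sqnorm x + 2 * x 0 i * h + h ^+ 2)).
  by apply/funext => h; rewrite sqnorm_shift mulrC.
apply: derE (der_cmul t^-1 _ _ _ (der_add _ _ _ _ _ (der_add _ _ _ _ _
  (der_cst (sqnorm x) 0) (der_cmul (2 * x 0 i) _ _ _ (der_id 0)))
  (der_sqr _ _ _ (der_id 0)))).
by ring.
Qed.

Lemma ssol_der_x (i : 'I_n) (x : 'rV[R]_n) (t : R) :
  is_derive x (delta_mx 0 i) (ssol ^~ t) (ssol_x i x t).
Proof.
apply: is_derive_dir; rewrite /ssol.
have E : sqnorm (0 *: delta_mx 0 i + x) / t = sqnorm x / t by rewrite scale0r add0r.
have Wd : is_derive (sqnorm (0 *: delta_mx 0 i + x) / t) 1 W (Y (sqnorm x / t)).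
  by rewrite E; exact: W_der.
have H := der_comp W (fun h : R => sqnorm (h *: delta_mx 0 i + x) / t) _ _ _ Wd (arg_der x i t).
apply: derE (der_cmul (t `^ m) _ _ _ H).
by rewrite /ssol_x; ring.
Qed.

Lemma ssol_der_xx (i j : 'I_n) (x : 'rV[R]_n) (t : R) : 0 < t ->
  is_derive x (delta_mx 0 j) (ssol_x i ^~ t) (ssol_xx i j x t).
Proof.
move=> t0; apply: is_derive_dir; rewrite /ssol_x.
apply: derE (der_cmul (2 * t `^ m / t) _ _
  ((j == i)%:R * Y (sqnorm x / t)
     + 2 * (x 0 i * x 0 j / sqnorm x) * Q (sqnorm x / t)) _) => //.
have cd : is_derive (0 : R) 1 (fun h : R => (h *: delta_mx 0 j + x) 0 i) (j == i)%:R.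
  have -> : (fun h : R => (h *: delta_mx 0 j + x) 0 i) = (fun h : R => x 0 i + h * (j == i)%:R).
    by apply/funext => h; rewrite coord_shift.
  apply: derE (der_add _ _ _ _ _ (der_cst _ _)
    (der_mul _ _ _ _ _ (der_id 0) (der_cst _ _))); ring.
have [x0|x0] := eqVneq (sqnorm x) 0.
  rewrite x0 mul0r Q0 mulr0 addr0.
  apply: der_of_le => e e0.
  have YC : {for (0 : R), continuous (fun h : R => Y (h ^+ 2 / t))}.
    apply: (@continuous_comp _ _ _ (fun h : R => h ^+ 2 / t) Y); last exact: Y_cont.
    by apply: cvgMr_tmp; rewrite expr2; apply: cvgM; exact: cvg_id.
  move/cvgrPdist_le : YC => /(_ _ e0) /near_le_exists[d d0 Hd].
  exists d => // h hd; rewrite add0r !coord_shift sqnorm_shift.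
  rewrite !(sqnorm_eq0 _ _ x0) x0 !mulr0 !mul0r !add0r.
  have := Hd h; rewrite subr0 expr0n /= mul0r => /(_ hd) H.
  rewrite mul0r subr0.
  have -> : h * (j == i)%:R * Y (h ^+ 2 / t) - h * ((j == i)%:R * Y 0) =
    - ((j == i)%:R * (h * (Y 0 - Y (h ^+ 2 / t)))) by ring.
  rewrite normrN normrM normrM mulrA [leRHS]mulrC; apply: ler_pM => //.
    by case: (j == i); rewrite ?normr1 ?mul1r// normr0 mul0r.
have s0 : 0 < sqnorm x by rewrite lt_neqAle sqnorm_ge0 eq_sym x0.
have E : sqnorm (0 *: delta_mx 0 j + x) / t = sqnorm x / t by rewrite scale0r add0r.
have Yd : is_derive (sqnorm (0 *: delta_mx 0 j + x) / t) 1 Y (Q (sqnorm x / t) / (sqnorm x / t)).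
  by rewrite E; apply: Y_der; rewrite divr_gt0.
have H := der_comp Y (fun h : R => sqnorm (h *: delta_mx 0 j + x) / t) _ _ _ Yd (arg_der x j t).
apply: derE (der_mul _ _ _ _ _ cd H).
rewrite scale0r add0r; field.
by rewrite x0 gt_eqF.
Qed.

Lemma ssol_der_t (x : 'rV[R]_n) (t : R) : 0 < t ->
  is_derive t 1 (ssol x) (ssol_t x t).
Proof.
move=> t0; rewrite /ssol.
have tn : t != 0 by rewrite gt_eqF.
have H1 := der_inv _ _ _ tn (der_id t).
have H2 := der_comp W (fun t : R => sqnorm x / t) _ _ _
  (W_der (sqnorm x / t)) (der_cmul (sqnorm x) _ _ _ H1).
apply: derE (der_mul _ _ _ _ _ (is_derive1_powR m t0) H2).
have -> : t `^ (m - 1) = t `^ m / t.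
  by rewrite powRB ?tn ?implybT// powRr1// ltW.
by rewrite /ssol_t; field.
Qed.

Lemma ssol_eq (x : 'rV[R]_n) (t : R) : 0 < t ->
  ssol_t x t - \sum_i ssol_xx i i x t = ssol x t * `|ssol x t| `^ (p - 1).
Proof.
move=> t0; have tn : t != 0 by rewrite gt_eqF.
have q0 : 1 - p != 0 by rewrite subr_eq0 eq_sym lt_eqF.
rewrite /ssol_xx -mulr_sumr big_split /=.
set s := sqnorm x / t.
have -> : \sum_(i < n) (i == i)%:R * Y s = n%:R * Y s.
  under eq_bigr do rewrite eqxx mul1r.
  by rewrite sumr_const card_ord mulr_natl.
have -> : \sum_(i < n) 2 * (x 0 i * x 0 i / sqnorm x) * Q s = 2 * Q s.
  rewrite -mulr_suml -mulr_sumr -mulr_suml.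
  have [x0|x0] := eqVneq (sqnorm x) 0.
    by rewrite /s x0 mul0r Q0 !mulr0.
  under eq_bigr do rewrite -expr2.
  by rewrite -/(sqnorm x) divff// mulr1.
have -> : ssol x t * `|ssol x t| `^ (p - 1) = t `^ m / t * spow p (W s).
  rewrite /ssol -/s normrM (ger0_norm (powR_ge0 _ _)) powRM ?powR_ge0//.
  rewrite -powRrM (_ : m * (p - 1) = - 1); last by rewrite /m; field.
  rewrite powR_inv1 ?(ltW t0)// /spow; ring.
rewrite /ssol_t -/s /Q /force -/m /N; field.
exact: tn.
Qed.

Let Z := ('rV[R]_n * R)%type.

Let fst_cont (i : 'I_n) (z : Z) : {for z, continuous (fun z : Z => z.1 0 i)}.
Proof.
apply: (@continuous_comp _ _ _ fst (fun x : 'rV[R]_n => x 0 i)); first exact: cvg_fst.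
exact: coord_continuous.
Qed.

Let sq_cont (z : Z) : {for z, continuous (fun z : Z => sqnorm z.1)}.
Proof.
apply: (@continuous_comp _ _ _ fst (@sqnorm R n)); first exact: cvg_fst.
exact: sqnorm_continuous.
Qed.

Let tV_cont (z : Z) : 0 < z.2 -> {for z, continuous (fun z : Z => z.2^-1)}.
Proof.
move=> z0; apply: (@continuous_comp _ _ _ snd (fun t : R => t^-1)); first exact: cvg_snd.
by apply: cvgV; [rewrite gt_eqF|exact: cvg_id].
Qed.

Let tm_cont (z : Z) : 0 < z.2 -> {for z, continuous (fun z : Z => z.2 `^ m)}.
Proof.
move=> z0; apply: (@continuous_comp _ _ _ snd (fun t : R => t `^ m)); first exact: cvg_snd.
exact: der_continuous (is_derive1_powR m z0).
Qed.

Let s_cont (f : R -> R) (z : Z) : continuous f -> 0 < z.2 ->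
  {for z, continuous (fun z : Z => f (sqnorm z.1 / z.2))}.
Proof.
move=> fc z0; apply: (@continuous_comp _ _ _ (fun z : Z => sqnorm z.1 / z.2) f); last exact: fc.
by apply: cvgM; [exact: sq_cont|exact: tV_cont].
Qed.

Lemma ssol_cont (z : Z) : 0 < z.2 -> {for z, continuous (fun z : Z => ssol z.1 z.2)}.
Proof. by move=> z0; apply: cvgM; [exact: tm_cont|exact: s_cont]. Qed.

Let pref_cont (z : Z) : 0 < z.2 -> {for z, continuous (fun z : Z => 2 * z.2 `^ m / z.2)}.
Proof.
move=> z0; apply: cvgM; last exact: tV_cont.
by apply: cvgMl_tmp; exact: tm_cont.
Qed.

Lemma ssol_x_cont (i : 'I_n) (z : Z) : 0 < z.2 ->
  {for z, continuous (fun z : Z => ssol_x i z.1 z.2)}.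
Proof.
move=> z0; apply: cvgM; first exact: pref_cont.
by apply: cvgM; [exact: fst_cont|exact: s_cont].
Qed.

Lemma ssol_t_cont (z : Z) : 0 < z.2 ->
  {for z, continuous (fun z : Z => ssol_t z.1 z.2)}.
Proof.
move=> z0; apply: cvgM; first by apply: cvgM; [exact: tm_cont|exact: tV_cont].
apply: cvgB; first by apply: cvgMl_tmp; exact: s_cont.
apply: cvgM; last exact: s_cont.
by apply: cvgM; [exact: sq_cont|exact: tV_cont].
Qed.

Lemma ssol_xx_cont (i j : 'I_n) (z : Z) : 0 < z.2 ->
  {for z, continuous (fun z : Z => ssol_xx i j z.1 z.2)}.
Proof.
move=> z0; apply: cvgM; first exact: pref_cont.
apply: cvgD; first by apply: cvgMl_tmp; exact: s_cont.
have Qz := s_cont Q z Q_cont z0.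
have [x0|x0] := eqVneq (sqnorm z.1) 0; last first.
  apply: cvgM => //; apply: cvgMl_tmp; apply: cvgM; first by apply: cvgM; exact: fst_cont.
  by apply: cvgV => //; exact: sq_cont.
have E : Q (sqnorm z.1 / z.2) = 0 by rewrite x0 mul0r Q0.
have Qz' : Q (sqnorm z'.1 / z'.2) @[z' --> z] --> (0 : R) by rewrite -E; exact: Qz.
pose H (y : Z) : R := 2 * (y.1 0 i * y.1 0 j / sqnorm y.1) * Q (sqnorm y.1 / y.2).
suff : H y @[y --> z] --> (0 : R) by rewrite E mulr0.
apply/norm_cvg0P.
apply: (@squeeze_cvgr _ _ _ _ (fun=> 0) (fun z' : Z => 2 * `|Q (sqnorm z'.1 / z'.2)|)).
- apply: filterE => z'; rewrite normr_ge0 /= /H normrM ler_wpM2r// normrM ger0_norm//.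
  rewrite ler_piMr// normrM normfV (ger0_norm (sqnorm_ge0 _)).
  have [y0|y0] := eqVneq (sqnorm z'.1) 0; first by rewrite y0 invr0 mulr0.
  by rewrite ler_pdivrMr ?mul1r ?norm_coord_mul_le// lt_neqAle sqnorm_ge0 eq_sym y0.
- exact: cvg_cst.
- by rewrite -(mulr0 2); apply: cvgMl_tmp; exact/norm_cvg0P.
Qed.

End self_similar.

Lemma within_DT {R : realType} (n : nat) (T : R) (f g : 'rV[R]_n * R -> R) :
  (forall z : 'rV[R]_n * R, 0 < z.2 <= T -> f z = g z) ->
  (forall z : 'rV[R]_n * R, 0 < z.2 -> {for z, continuous g}) ->
  {within @DT R n T, continuous f}.
Proof.
move=> fg gc; apply: (@subspace_eq_continuous _ _ _ (g : subspace (@DT R n T) -> R)).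
  by move=> z; rewrite inE => zT; exact/esym/fg.
apply: continuous_in_subspaceT => z; rewrite inE => /andP[z0 _].
exact: gc.
Qed.

Section within_time.
Context {R : realType} (T t : R).
Hypothesis tT : 0 < t <= T.

Let F := within [set h : R | 0 < t + h <= T] 0^'.

Let FP : ProperFilter F.
Proof.
case/andP: tT => t0 tT'.
split; last exact: within_filter.
rewrite /F /within /= /dnbhs /within /= => /nbhs_ballP[e /= e0 He].
pose h := - Num.min (e / 2) (t / 2).
have hp : 0 < Num.min (e / 2) (t / 2) by rewrite lt_min !divr_gt0.
have h1 : Num.min (e / 2) (t / 2) <= e / 2 by rewrite ge_min lexx.
have h2 : Num.min (e / 2) (t / 2) <= t / 2 by rewrite ge_min lexx orbT.
apply: (He h).
- rewrite /ball /= sub0r opprK gtr0_norm//; lra.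
- by rewrite oppr_eq0 gt_eqF.
- by rewrite /h; apply/andP; split; lra.
Qed.

Lemma tderivable_td (g : R -> R) (d : R) : is_derive t 1 g d ->
  tderivable T g t /\ td T g t = d.
Proof.
move=> [gd gE].
have H : h^-1 * (g (t + h) - g t) @[h --> F] --> d.
  have E : (fun h => h^-1 * (g (t + h) - g t)) =
      (fun h : R => h^-1 *: (g (h *: (1 : R) + t) - g t)).
    by apply/funext => h; rewrite [_%:A]mulr1 [h + t]addrC.
  by rewrite E -gE; apply: cvg_within_filter; exact: gd.
by split; [apply/cvg_ex; exists d|apply/cvg_lim].
Qed.

End within_time.

Section solution.
Context {R : realType}.
Variables (n : nat) (p a T : R) (W Y : R -> R).
Hypotheses (p_gt0 : 0 < p) (p_lt1 : p < 1) (a_gt0 : 0 < a) (T_gt0 : 0 < T).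
Hypothesis WY : profile n p a W Y.

Let u : 'rV[R]_n -> R -> R := ssol n p W.

Let pdE i (x : 'rV[R]_n) t : pd i (u ^~ t) x = ssol_x n p Y i x t.
Proof. by have [_ H] := ssol_der_x n p a W Y WY i x t; exact: H. Qed.

Let pdpdE i j (x : 'rV[R]_n) t : 0 < t ->
  pd j (pd i (u ^~ t)) x = ssol_xx n p W Y i j x t.
Proof.
move=> t0; have -> : pd i (u ^~ t) = ssol_x n p Y i ^~ t by apply/funext => y; exact: pdE.
by have [_ H] := ssol_der_xx n p a W Y WY i j x t t0; exact: H.
Qed.

Lemma ssol_C21 : C21 T u.
Proof.
split.
- by apply: (within_DT n T _ (fun z => u z.1 z.2)) => // z z0; exact: (ssol_cont n p a W Y WY).
- split=> [x t tT|].
    have t0 : 0 < t by case/andP: tT.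
    by have [] := tderivable_td T t tT _ _ (ssol_der_t n p a W Y WY x t t0).
  apply: (within_DT n T _ (fun z => ssol_t n p W Y z.1 z.2)) => z z0; last first.
    exact: (ssol_t_cont n p a W Y WY).
  have zp : 0 < z.2 by case/andP: z0.
  by have [_ H] := tderivable_td T z.2 z0 _ _ (ssol_der_t n p a W Y WY z.1 z.2 zp); exact: H.
- move=> i; split=> [x t _|].
    by have [] := ssol_der_x n p a W Y WY i x t.
  apply: (within_DT n T _ (fun z => ssol_x n p Y i z.1 z.2)) => z z0; first exact: pdE.
  exact: (ssol_x_cont n p a W Y WY).
- move=> i j; split=> [x t /andP[t0 _]|].
    have -> : pd i (u ^~ t) = ssol_x n p Y i ^~ t by apply/funext => y; exact: pdE.
    by have [] := ssol_der_xx n p a W Y WY i j x t t0.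
  apply: (within_DT n T _ (fun z => ssol_xx n p W Y i j z.1 z.2)) => z z0.
    by apply: pdpdE; case/andP: z0.
  exact: (ssol_xx_cont n p a W Y p_gt0 WY).
Qed.

Let m_ge1 : 1 <= (1 - p)^-1.
Proof. by rewrite invf_ge1 ?subr_gt0// gerBl ltW. Qed.

Lemma ssol0 x : u x 0 = 0.
Proof. by rewrite /u /ssol powR0 ?mul0r// gt_eqF// (lt_le_trans _ m_ge1). Qed.

Lemma ssol_le x t : 0 <= t -> `|u x t| <= a * t `^ (1 - p)^-1.
Proof.
move=> t0; rewrite /u /ssol normrM ger0_norm ?powR_ge0// mulrC ler_wpM2r ?powR_ge0//.
by case: WY => _ [_ H _ _ _]; apply: H; rewrite divr_ge0// sqnorm_ge0.
Qed.

Lemma ssol_DTbar_cont : {within @DTbar R n T, continuous (fun z => u z.1 z.2)}.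
Proof.
apply/subspace_continuousP => z /andP[]; rewrite le_eqVlt => /predU1P[z0 _|z0 _].
  have H : u y.1 y.2 @[y --> within (@DTbar R n T) (nbhs z)] --> u z.1 z.2; last exact: H.
  rewrite -z0 ssol0; apply/cvgrPdist_le => e e0.
  have d0 : 0 < Num.min 1 (e / a) by rewrite lt_min ltr01 divr_gt0.
  rewrite near_withinE.
  have : \forall y \near z, `|z.2 - y.2| <= Num.min 1 (e / a).
    have /cvgrPdist_le/(_ _ d0) : (fun y : 'rV[R]_n * R => y.2) @ z --> z.2 by exact: cvg_snd.
    by [].
  apply: filterS => y; rewrite -z0 sub0r normrN le_min => /andP[y1 y2] /andP[y0 _].
  move: y1 y2; rewrite ger0_norm// => y1 y2.
  rewrite sub0r normrN; apply: le_trans (ssol_le _ _ y0) _.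
  rewrite -ler_pdivlMl// mulrC; apply: le_trans y2.
  move: y0; rewrite le_eqVlt => /predU1P[<-|y0].
    by rewrite powR0// gt_eqF// (lt_le_trans _ m_ge1).
  by apply: ge1r_powR => //; rewrite y0.
apply: cvg_within_filter; exact: (ssol_cont n p a W Y WY).
Qed.

Lemma ssol_Linfty : Linfty T u.
Proof.
exists (a * T `^ (1 - p)^-1); apply: aeW => z /andP[z0 zT].
apply: le_trans (ssol_le _ _ z0) _; rewrite ler_pM2l//.
by apply: le_powR => //; rewrite (le_trans _ m_ge1).
Qed.

Lemma ssol_CP : CP_solution p T u.
Proof.
split; [exact: ssol_C21|exact: ssol_DTbar_cont|exact: ssol_Linfty| |exact: ssol0].
move=> x t tT; have t0 : 0 < t by case/andP: tT.
have [_ ->] := tderivable_td T t tT _ _ (ssol_der_t n p a W Y WY x t t0).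
rewrite -(ssol_eq n p a W Y p_lt1 WY x t t0); congr (_ - _).
by apply: eq_bigr => i _; exact: pdpdE.
Qed.

Lemma ssol_enorm x t : 0 < t ->
  u x t = W ((enorm x / Num.sqrt t) ^+ 2) * t `^ (1 - p)^-1.
Proof.
move=> t0; rewrite /u /ssol mulrC exprMn exprVn (sqr_sqrtr (ltW t0)).
by rewrite (sqr_sqrtr (sqnorm_ge0 x)).
Qed.

Lemma ssol_radial : radially_symmetric T u.
Proof.
move=> x y t _ xy; rewrite /u /ssol.
suff -> : sqnorm x = sqnorm y by [].
by rewrite -(sqr_sqrtr (sqnorm_ge0 x)) -(sqr_sqrtr (sqnorm_ge0 y)); congr (_ ^+ 2).
Qed.

Lemma ssol_inhomogeneous : (0 < n)%N -> spatially_inhomogeneous T u.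
Proof.
move=> n0 [g gE].
have TT : 0 <= T <= T by rewrite lexx ltW.
have Tm : 0 < T `^ (1 - p)^-1 by rewrite powR_gt0.
case: WY => -[W0 _ _ _] [_ _ _ H _].
have [s s1 Ws] := H 1 ltr01.
have s0 : 0 <= s by rewrite (le_trans _ s1).
pose x : 'rV[R]_n := Num.sqrt (s * T) *: delta_mx 0 (Ordinal n0) + 0.
have xs : sqnorm x = s * T.
  have sq0 : sqnorm (0 : 'rV[R]_n) = 0.
    by rewrite /sqnorm big1// => i _; rewrite mxE expr0n.
  rewrite /x sqnorm_shift sq0 mxE mulr0 mul0r !add0r sqr_sqrtr// mulr_ge0// ltW//.
have : u x T = u 0 T by rewrite !gE.
rewrite /u /ssol xs mulfK ?gt_eqF// Ws mulr0.
have -> : sqnorm (0 : 'rV[R]_n) = 0.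
  by rewrite /sqnorm big1// => i _; rewrite mxE expr0n.
rewrite mul0r W0 => /esym/eqP; rewrite mulf_eq0 !gt_eqF//.
Qed.

End solution.

(** * Integrability *)

Section rcons.
Context {R : realType} (n : nat).
Implicit Types z : 'rV[R]_n * R.

Lemma rV_rcons_max z : rV_rcons z 0 ord_max = z.2.
Proof. by rewrite mxE unlift_none. Qed.

Lemma rV_rcons_widen z (i : 'I_n) : rV_rcons z 0 (widen_ord (leqnSn n) i) = z.1 0 i.
Proof.
rewrite mxE; have -> : widen_ord (leqnSn n) i = lift ord_max i.
  by apply: val_inj; rewrite /= /bump leqNgt ltn_ord.
by rewrite liftK.
Qed.

Lemma sqnorm_rcons z : sqnorm (rV_rcons z) = sqnorm z.1 + z.2 ^+ 2.
Proof.
rewrite /sqnorm big_ord_recr /= rV_rcons_max; congr (_ + _).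
by apply: eq_bigr => i _; rewrite rV_rcons_widen.
Qed.

Lemma prod_rcons (g : R -> R) z :
  \prod_i g (rV_rcons z 0 i) = (\prod_i g (z.1 0 i)) * g z.2.
Proof.
rewrite big_ord_recr /= rV_rcons_max; congr (_ * _).
by apply: eq_bigr => i _; rewrite rV_rcons_widen.
Qed.

End rcons.

Section measurability.
Context {R : realType} (n : nat).

Lemma measurable_coord (i : 'I_n) : measurable_fun [set: 'rV[R]_n] (fun x => x 0 i).
Proof.
move=> _ Y mY; rewrite setTI; apply: sub_sigma_algebra => /=.
rewrite -bigcup_seq/=; exists i => /=; first by rewrite mem_index_enum.
by exists Y => //; rewrite setTI.
Qed.

Lemma measurable_sqnorm : measurable_fun [set: 'rV[R]_n] (@sqnorm R n).
Proof.
apply: measurable_sum => i; apply: measurable_funX.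
exact: measurable_coord.
Qed.

End measurability.

Section sigma_finite_lebesgue_rV.
Context {R : realType}.

Let ball_ (n k : nat) : set 'rV[R]_n := [set x | sqnorm x <= k%:R].

Let measurable_ball n k : measurable (ball_ n k).
Proof.
have := @measurable_sqnorm R n measurableT `]-oo, k%:R]%classic (measurable_itv _).
by rewrite setTI; congr (measurable _).
Qed.

Lemma lebesgue_rV_ball (n k : nat) : (lebesgue_rV R n (ball_ n k) < +oo)%E.
Proof.
elim: n => [|n IH].
  by rewrite /= diracE ltry.
have mI : measurable (`[- (k%:R + 1), k%:R + 1]%classic : set R) by exact: measurable_itv.
apply: (@le_lt_trans _ _ ((lebesgue_rV R n \x @lebesgue_measure R)%E
    (ball_ n k `*` `[- (k%:R + 1), k%:R + 1]%classic))).
  apply: (@le_measure _ _ _ (lebesgue_rV R n \x @lebesgue_measure R)%E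
    (@rV_rcons R n @^-1` ball_ n.+1 k)).
  - rewrite inE; have := measurable_rV_rcons measurableT (measurable_ball n.+1 k).
    by rewrite setTI.
  - by rewrite inE; apply: measurableX; [exact: measurable_ball|exact: mI].
  - move=> [x y]; rewrite /ball_ /= sqnorm_rcons /= => h.
    have h1 := sqr_ge0 y; have h2 := sqnorm_ge0 x.
    split; first by lra.
    have k0 : 0 <= k%:R :> R by [].
    by rewrite /= in_itv /=; apply/andP; split; nra.
rewrite product_measure1E//; last exact: measurable_ball.
apply: lte_mul_pinfty => //.
  by rewrite ge0_fin_numE.
by rewrite /= lebesgue_measure_itv /=; case: ifP; rewrite ?ltry// -EFinD ltry.
Qed.

Lemma sigma_finite_lebesgue_rV (n : nat) : sigma_finite [set: 'rV[R]_n] (lebesgue_rV R n).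
Proof.
exists (ball_ n); last by move=> k; split; [exact: measurable_ball|exact: lebesgue_rV_ball].
apply/seteqP; split => // x _; exists (Num.truncn (sqnorm x)).+1 => //=.
by rewrite /ball_ /= ltW// truncnS_gt.
Qed.

End sigma_finite_lebesgue_rV.

Section product_integrals.
Context {R : realType}.
Local Open Scope ereal_scope.

Section pack.
Variable n : nat.

(* [lebesgue_rV] is a recursively defined packed measure; a sigma-finite instance can
   only be attached to a named set function. *)
Definition leb_rV : set 'rV[R]_n -> \bar R := lebesgue_rV R n.

HB.instance Definition _ := Measure.on leb_rV.

HB.instance Definition _ := @Measure_isSigmaFinite.Build _ _ _ leb_rV
  (sigma_finite_lebesgue_rV n).

End pack.

Lemma ge0_integral_rcons (n : nat) (mu : {measure set 'rV[R]_n -> \bar R})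
    (f : 'rV[R]_n.+1 -> \bar R) : measurable_fun setT f -> (forall x, 0 <= f x) ->
  \int[rcons_measure mu]_x f x =
  \int[mu \x @lebesgue_measure R]_z f (rV_rcons z).
Proof.
move=> mf f0.
have mphi : @measurable_fun _ _ ('rV[R]_n * measurableTypeR R)%type 'rV[R]_n.+1
  setT (@rV_rcons R n) := @measurable_rV_rcons R n.
pose nu : {measure set (measurableTypeR R) -> \bar R} := @lebesgue_measure R.
exact: (@ge0_integral_pushforward _ _ _ _ R _ mphi (mu \x nu) setT f measurableT mf
  (fun x _ => f0 x)).
Qed.

Lemma integral_prod_lty (n : nat) (g : R -> R) : (forall x, (0 <= g x)%R) ->
  measurable_fun setT g -> \int[lebesgue_measure]_x (g x)%:E < +oo ->
  \int[lebesgue_rV R n]_x (\prod_(i < n) g (x 0 i))%:E < +oo.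
Proof.
move=> g0 mg gI; elim: n => [|n IH].
  rewrite integral_dirac//.
    by rewrite diracT mul1e ltry.
  by apply/measurable_EFinP; apply: measurable_prod => -[].
have mpr m : measurable_fun [set: 'rV[R]_m] (fun x => \prod_(i < m) g (x 0 i))%R.
  apply: measurable_prod => i _.
  by apply: measurableT_comp => //; exact: measurable_coord.
have mp m : measurable_fun [set: 'rV[R]_m] (fun x => (\prod_(i < m) g (x 0 i))%:E).
  by apply/measurable_EFinP; exact: mpr.
have p0 m (x : 'rV[R]_m) : (0 <= \prod_(i < m) g (x 0 i))%R by exact: prodr_ge0.
have -> : \int[lebesgue_rV R n.+1]_x (\prod_(i < n.+1) g (x 0 i))%:E =
    \int[leb_rV n \x lebesgue_measure]_z ((\prod_(i < n) g (z.1 0 i)) * g z.2)%:E.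
  rewrite [LHS](ge0_integral_rcons _ _ _ (mp n.+1)); last by move=> x; rewrite lee_fin.
  by apply: eq_integral => z _; rewrite /= prod_rcons.
rewrite fubini_tonelli1//; last first.
- by move=> z; rewrite lee_fin mulr_ge0.
- apply/measurable_EFinP; apply: measurable_funM.
    exact: (measurableT_comp (mpr n) (@measurable_fst _ _ _ _)).
  exact: (measurableT_comp mg (@measurable_snd _ _ _ _)).
rewrite /fubini_F /=.
have -> : \int[leb_rV n]_x \int[lebesgue_measure]_y (\prod_(i < n) g (x 0 i) * g y)%:E =
    \int[lebesgue_rV R n]_x ((\prod_(i < n) g (x 0 i))%:E * \int[lebesgue_measure]_y (g y)%:E).
  apply: eq_integral => x _; under eq_integral do rewrite EFinM.
  rewrite ge0_integralZl//; first exact/measurable_EFinP.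
    by move=> y _; rewrite lee_fin.
  by rewrite lee_fin.
rewrite ge0_integralZr//; last first.
- by apply: integral_ge0 => y _; rewrite lee_fin.
- by move=> x _; rewrite lee_fin.
- exact: mp.
apply: lte_mul_pinfty => //.
- by apply: integral_ge0 => y _; rewrite lee_fin.
- by rewrite ge0_fin_numE//; apply: integral_ge0 => y _; rewrite lee_fin.
Qed.

Lemma integral_oneDsqrV_lty :
  \int[@lebesgue_measure R]_x ((1 + x ^+ 2)^-1)%:E < +oo.
Proof.
rewrite (@ge0_symfun_integralT R (fun x => (1 + x ^+ 2)^-1)%R).
- by rewrite -set_itvcy integral0y_oneDsqr -EFinM ltry.
- by move=> x; rewrite invr_ge0 addr_ge0// sqr_ge0.
- by move=> x; exact: continuous_oneDsqrV.
- by move=> x /=; rewrite sqrrN.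
Qed.

End product_integrals.

Lemma prod_oneD_le {R : realType} (n : nat) (x : 'rV[R]_n) :
  \prod_(i < n) (1 + x 0 i ^+ 2) <= (1 + sqnorm x) ^+ n.
Proof.
rewrite -[X in _ ^+ X]card_ord -prodr_const; apply: ler_prod => i _.
by rewrite addr_ge0 ?sqr_ge0//= lerD2l sqr_coord_le.
Qed.

Section Lnorm_solution.
Context {R : realType}.
Variables (n : nat) (p a : R) (W Y : R -> R).
Hypotheses (p_gt0 : 0 < p) (p_lt1 : p < 1) (WY : profile n p a W Y).

Let u : 'rV[R]_n -> R -> R := ssol n p W.

Lemma ssol_powR_le (q t : R) : 0 < q -> 0 <= t -> exists2 C : R, 0 <= C &
  forall x, `|u x t| `^ q <= C * \prod_(i < n) (1 + x 0 i ^+ 2)^-1.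
Proof.
move=> q0; rewrite le_eqVlt => /predU1P[<-|t0].
  by exists 0 => // x; rewrite /u (ssol0 n p W p_gt0 p_lt1) normr0 powR0 ?gt_eqF// mul0r.
case: WY => _ [_ _ _ _ /(_ q q0)[C C0 HC]].
have t1 : 0 < 1 + t by rewrite addr_gt0.
have tm := powR_ge0 t ((1 - p)^-1 * q).
exists (t `^ ((1 - p)^-1 * q) * (C * (1 + t) ^+ n)) => [|x].
  by rewrite mulr_ge0// mulr_ge0 ?exprn_ge0 ?ltW.
have s0 : 0 <= sqnorm x / t by rewrite divr_ge0 ?sqnorm_ge0 ?ltW.
rewrite prodfV ler_pdivlMr; last first.
  by apply: prodr_gt0 => i _; rewrite ltr_wpDr ?sqr_ge0.
rewrite /u /ssol normrM (ger0_norm (powR_ge0 _ _)) powRM ?powR_ge0// -powRrM -mulrA.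
rewrite ler_wpM2l//; apply: le_trans (ler_wpM2l (powR_ge0 _ _) (prod_oneD_le _ x)) _.
apply: (@le_trans _ _ (`|W (sqnorm x / t)| `^ q * (1 + sqnorm x / t) ^+ n * (1 + t) ^+ n)).
  rewrite -mulrA ler_wpM2l ?powR_ge0// -exprMn lerXn2r
    ?nnegrE ?mulr_ge0 ?addr_ge0 ?sqnorm_ge0 ?(ltW t0)//.
  have -> : (1 + sqnorm x / t) * (1 + t) = 1 + sqnorm x + (t + sqnorm x / t).
    by field; rewrite gt_eqF.
  by rewrite lerDl addr_ge0// ltW.
by rewrite ler_wpM2r ?exprn_ge0 ?(ltW t1)// HC.
Qed.

Lemma measurable_ssol (t : R) : measurable_fun [set: 'rV[R]_n] (u ^~ t).
Proof.
apply: measurable_funM; first exact: measurable_cst.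
have Wc : continuous W by case: WY => -[_ _ Wd _] _ s; exact: der_continuous (Wd s).
apply: (measurableT_comp (continuous_measurable_fun Wc)).
by apply: measurable_funM; [exact: measurable_sqnorm|exact: measurable_cst].
Qed.

Local Open Scope ereal_scope.

Lemma ssol_Lnorm_lty (q t : R) : (0 < q)%R -> (0 <= t)%R ->
  'N[lebesgue_rV R n]_q%:E[(fun x => (u x t)%:E)] < +oo.
Proof.
move=> q0 t0; rewrite unlock; apply: poweR_lty.
have [C C0 HC] := ssol_powR_le q t q0 t0.
pose g (x : R) : R := (1 + x ^+ 2)^-1%R.
have g0 x : (0 <= g x)%R by rewrite invr_ge0 addr_ge0// sqr_ge0.
have mg : measurable_fun setT g.
  by apply: continuous_measurable_fun => x; exact: continuous_oneDsqrV.
have pg0 (x : 'rV[R]_n) : (0 <= \prod_(i < n) g (x 0 i))%R by exact: prodr_ge0.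
have mpg : measurable_fun [set: 'rV[R]_n] (fun x => \prod_(i < n) g (x 0 i))%R.
  apply: measurable_prod => i _.
  by apply: measurableT_comp => //; exact: measurable_coord.
have I := integral_prod_lty n g g0 mg integral_oneDsqrV_lty.
apply: (@le_lt_trans _ _ (\int[lebesgue_rV R n]_x (C%:E * (\prod_(i < n) g (x 0 i))%:E))).
  apply: ge0_le_integral => //.
  - by move=> x _; exact: poweR_ge0.
  - have mu : measurable_fun [set: 'rV[R]_n] (fun x => (`|u x t| `^ q)%R%:E).
      apply/measurable_EFinP; apply: (measurableT_comp (measurable_powR q)).
      by apply: measurableT_comp => //; exact: measurable_ssol.
    exact: mu.
  - apply/measurable_EFinP; apply: measurable_funM => //.
  - by move=> x _; rewrite /= lee_fin HC.
rewrite ge0_integralZl//; last first.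
- by move=> x _; rewrite lee_fin.
- exact/measurable_EFinP.
apply: lte_mul_pinfty => //.
Qed.

End Lnorm_solution.

Theorem mainTheorem4 (R : realType) (n : nat) (p T : R)
    (hn : (0 < n)%N) (hp : 0 < p < 1) (hT : 0 < T) :
  exists (w : R -> R -> R) (u : R -> 'rV[R]_n -> R -> R),
    forall alpha : R, 0 < alpha < (1 - p) `^ (1 - p)^-1 ->
      [/\ CP_solution p T (u alpha),
          spatially_inhomogeneous T (u alpha) /\
            radially_symmetric T (u alpha),
          (forall (x : 'rV[R]_n) (t : R), 0 < t <= T ->
             u alpha x t = w alpha (enorm x / Num.sqrt t) * t `^ (1 - p)^-1) /\
            (forall x : 'rV[R]_n, u alpha x 0 = 0),
          w alpha 0 = alpha /\ oscillates (w alpha)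
        & forall q : R, (1 - p) * n%:R / 2 < q ->
            forall t : R, 0 <= t <= T ->
              ('N[lebesgue_rV R n]_q%:E[(fun x => (u alpha x t)%:E)] < +oo)%E].
Proof.
have H (alpha : R) : exists WY : (R -> R) * (R -> R),
    0 < alpha < (1 - p) `^ (1 - p)^-1 -> profile n p alpha WY.1 WY.2.
  have [h|h] := boolP (0 < alpha < (1 - p) `^ (1 - p)^-1).
    by have [W [Y WY]] := profile_exists n p alpha hn hp h; exists (W, Y).
  by exists (id, id).
have [F HF] := choice H.
exists (fun alpha eta => (F alpha).1 (eta ^+ 2)), (fun alpha => ssol n p (F alpha).1).
move=> alpha ha; have WY := HF _ ha.
have [p0 p1] := andP hp; have [a0 _] := andP ha.
split.
- exact: (ssol_CP n p alpha T _ _ p0 p1 a0 WY).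
- split; first exact: (ssol_inhomogeneous n p alpha T _ _ a0 hT WY hn).
  exact: (ssol_radial n p T).
- split=> [x t /andP[t0 _]|x]; first exact: ssol_enorm.
  exact: ssol0.
- split; last exact: (profile_oscillates n p alpha _ _ a0 WY).
  by rewrite expr0n /=; case: WY => -[].
- move=> q hq t /andP[t0 _]; apply: (ssol_Lnorm_lty n p alpha _ _ p0 p1 WY) => //.
  by apply: le_lt_trans hq; rewrite divr_ge0// mulr_ge0// subr_ge0 ltW.
Qed.
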